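(* Let $n\ge1$ and let $\mathcal E$ be a metrizable commutative topological ring containing $\mathbb Q$ with the same unit; let $\overline{\mathbb Z}$ be the closure of $\mathbb Z$ in $\mathcal E$. Let $\mathrm{Fr}_n^\circ(\mathcal E)$ be the group of all $g\in\mathrm{Afr}_n(\mathcal E)$ with constant term $1$ satisfying $\delta(g)=g\otimes g$, and let $\mathrm{Fr}_n^\circ[\mathcal E,\mathbb Z]$ (resp. $\mathrm{Fr}_n^\circ[\mathcal E,\overline{\mathbb Z}]$) be the subgroup of those $g$ all of whose coefficients lie in $\mathbb Z$ (resp. in $\overline{\mathbb Z}$). Then: (a) Each element $g\in\mathrm{Fr}_n^\circ(\mathcal E)$ can be represented in a unique way as a product $$g=\prod_{L}\Xi_L(1+\omega_1,\dots,1+\omega_n)^{t_L},\qquad t_L\in\mathcal E,$$ where $L$ ranges over all Lyndon words in $a_1,\dots,a_n$ and the factors are written from left to right in increasing order with respect to $\lessdot$. (b) An element $g\in\mathrm{Fr}_n^\circ(\mathcal E)$ is contained in $\mathrm{Fr}_n^\circ[\mathcal E,\mathbb Z]$ if and only if all the exponents $t_L$ in this product lie in $\mathbb Z$. (c) An element $g\in\mathrm{Fr}_n^\circ(\mathcal E)$ is contained in $\mathrm{Fr}_n^\circ[\mathcal E,\overline{\mathbb Z}]$ if and only if all the exponents $t_L$ in this product lie in $\overline{\mathbb Z}$.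
   Context: Addition and multiplication in $\mathcal E$ are assumed jointly continuous. $\mathrm{Afr}_n(\mathcal E)$ is the algebra of formal noncommutative associative series $\sum_\alpha c_\alpha\omega^\alpha$, $c_\alpha\in\mathcal E$, in $\omega_1,\dots,\omega_n$, where $\omega^\alpha=\omega_{\alpha_1}\cdots\omega_{\alpha_k}$, $\alpha=(\alpha_1,\dots,\alpha_k)$, $k\ge0$, $|\alpha|:=k$; it has the topology of coefficient-wise convergence. $\mathrm{Afr}_n(\mathcal E)\otimes\mathrm{Afr}_n(\mathcal E)$ is the algebra of formal series $\sum h_{\alpha,\beta}\,\omega^\alpha\otimes\omega^\beta$, $h_{\alpha,\beta}\in\mathcal E$, with factorwise multiplication, and $\delta:\mathrm{Afr}_n(\mathcal E)\to\mathrm{Afr}_n(\mathcal E)\otimes\mathrm{Afr}_n(\mathcal E)$ is the continuous unital $\mathcal E$-algebra homomorphism with $\delta(\omega_j)=\omega_j\otimes1+1\otimes\omega_j+\omega_j\otimes\omega_j$. For a series $x$ with zero constant term and $t\in\mathcal E$, $(1+x)^t:=\sum_{m\ge0}\frac{t(t-1)\cdots(t-m+1)}{m!}x^m$. Lyndon words: order words in the alphabet $a_1,\dots,a_n$ lexicographically ($\prec$, with $a_1\prec\dots\prec a_n$). A Lyndon word is a nonempty word that is $\prec$-less than each of its proper nonempty suffixes. The order $\lessdot$ on words: $\alpha\lessdot\beta$ if $|\alpha|<|\beta|$, or if $|\alpha|=|\beta|$ and $\alpha\prec\beta$. For elements $g_1,\dots,g_n$ of a group and a Lyndon word $L$, $\Xi_L(g_1,\dots,g_n)$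 is defined recursively: $\Xi_{a_j}(g_1,\dots,g_n)=g_j$; if $|L|>1$, write $L=vw$ with $w$ the longest proper suffix of $L$ that is a Lyndon word (then $v$ is also Lyndon) and put $\Xi_L=\{\Xi_v,\Xi_w\}$, where $\{g,h\}:=g^{-1}h^{-1}gh$. The infinite product is understood as the coefficient-wise limit: modulo series with all terms of degree $>m$, the factors with $|L|>m$ are equal to $1$, so only finitely many factors matter. *)

(* Defs.v *)
From HB Require Import structures.
From mathcomp Require Import all_boot all_order all_algebra.
From mathcomp Require Import boolp classical_sets functions reals topology tvs.

Set Implicit Arguments.
Unset Strict Implicit.
Unset Printing Implicit Defensive.

Import Order.TTheory GRing.Theory Num.Theory.

Local Open Scope classical_set_scope.
Local Open Scope ring_scope.

HB.mixin Record TopologicalZmodule_isTopologicalRing E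
    of TopologicalZmodule E & GRing.PzRing E := {
  mul_continuous : continuous (fun x : E * E => x.1 * x.2)
}.

#[short(type="topComRingType")]
HB.structure Definition TopologicalComRing :=
  {E of TopologicalZmodule E & GRing.ComPzRing E
      & TopologicalZmodule_isTopologicalRing E}.

Definition metrizable (R : realType) (T : topologicalType) : Prop :=
  exists d : T -> T -> R,
    [/\ forall x y, d x y = 0 <-> x = y,
        forall x y, d x y = d y x,
        forall x y z, d x z <= d x y + d y z &
        forall x, nbhs x = filter_from [set e : R | 0 < e]
                                       (fun e => [set y | d x y < e])].

Definition integers (E : pzRingType) : set E :=
  range (fun z : int => z%:~R : E).
Arguments integers : clear implicits.

Definition word (n : nat) := seq 'I_n.

(* The series [\sum_w f w . omega^w] is the function [f].  The ring of
   coefficients need not be commutative, but it commutes with the variables. *)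
Definition series (n : nat) (A : Type) := word n -> A.

HB.instance Definition _ n (A : zmodType) :=
  GRing.Zmodule.copy (series n A) (word n -> A).

(* the topology of coefficient-wise convergence *)
HB.instance Definition _ n (A : topologicalType) :=
  Topological.copy (series n A) {ptws word n -> A}.

Section SeriesRing.
Variables (n : nat) (A : pzRingType).
Implicit Types (f g h : series n A) (a c : A) (w : word n).

Definition const_series c : series n A := fun w => if w is [::] then c else 0.

Definition mul_series f g : series n A :=
  fun w => \sum_(i < (size w).+1) f (take i w) * g (drop i w).

Local Notation "f ** g" := (mul_series f g) (at level 40).
Let shift (j : 'I_n) f : series n A := fun w => f (j :: w).
Let scale c f : series n A := fun w => c * f w.

Let mulS_nil f g : (f ** g) [::] = f [::] * g [::].
Proof. by rewrite /mul_series big_ord1. Qed.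

Let mulS_cons f g j w :
  (f ** g) (j :: w) = f [::] * g (j :: w) + (shift j f ** g) w.
Proof. by rewrite /mul_series big_ord_recl. Qed.

Let mulSDl : left_distributive mul_series +%R.
Proof.
move=> f g h; apply/funext => w; rewrite /mul_series -[RHS]big_split /=.
by apply: eq_bigr => i _; rewrite -mulrDl.
Qed.

Let mulSDr : right_distributive mul_series +%R.
Proof.
move=> f g h; apply/funext => w; rewrite /mul_series -[RHS]big_split /=.
by apply: eq_bigr => i _; rewrite -mulrDr.
Qed.

Let scale_mulS c f g : scale c f ** g = scale c (f ** g).
Proof.
apply/funext => w; rewrite /scale /mul_series mulr_sumr.
by apply: eq_bigr => i _; rewrite mulrA.
Qed.

Let shift_mulS j f g :
  shift j (f ** g) = scale (f [::]) (shift j g) + shift j f ** g.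
Proof. by apply/funext => w; rewrite /shift mulS_cons. Qed.

Let mulSA : associative mul_series.
Proof.
move=> f g h; apply/funext => w; elim: w f g => [|j w IHw] f g.
  by rewrite !mulS_nil mulrA.
rewrite !mulS_cons mulS_nil shift_mulS mulSDl scale_mulS IHw.
by rewrite mulrDr mulrA -addrA.
Qed.

Let mul1S : left_id (const_series 1) mul_series.
Proof.
move=> f; apply/funext => w; rewrite /mul_series big_ord_recl /= take0 drop0.
rewrite mul1r big1 ?addr0 // => i _; case: w i => [|j w] [] //= i _.
by rewrite mul0r.
Qed.

Let mulS1 : right_id (const_series 1) mul_series.
Proof.
move=> f; apply/funext => w; rewrite /mul_series big_ord_recr /=.
rewrite take_size drop_size mulr1 big1 ?add0r // => i _.
case E: (drop i w) => [|j v] /=; last by rewrite mulr0.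
by have := size_drop i w; rewrite E /= => /eqP; rewrite eq_sym subn_eq0 leqNgt ltn_ord.
Qed.

HB.instance Definition _ :=
  GRing.Zmodule_isPzRing.Build (series n A) mulSA mul1S mulS1 mulSDl mulSDr.

Lemma addSE f g w : (f + g) w = f w + g w. Proof. by []. Qed.
Lemma oppSE f w : (- f) w = - f w. Proof. by []. Qed.
Lemma mulSE f g w :
  (f * g) w = \sum_(i < (size w).+1) f (take i w) * g (drop i w).
Proof. by []. Qed.
Lemma oneSE w : (1 : series n A) w = (w == [::])%:R.
Proof. by case: w. Qed.
Lemma sumSE I (r : seq I) (P : pred I) (F : I -> series n A) w :
  (\sum_(i <- r | P i) F i) w = \sum_(i <- r | P i) F i w.
Proof. by elim/big_rec2: _ => // i y x _ <-. Qed.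

Definition omega (j : 'I_n) : series n A := fun w => (w == [:: j])%:R.

End SeriesRing.

Arguments const_series {n A} c.
Arguments omega {n A} j.

Section OneSeries.
Variables (n : nat) (A : pzRingType).

(* the group of series with constant term 1 *)
Record one_series :=
  OneSeries { one_series_val :> series n A; _ : one_series_val [::] == 1 }.

HB.instance Definition _ := [isSub for one_series_val].
HB.instance Definition _ := [Choice of one_series by <:].

Implicit Types (f g x : series n A) (u v : one_series).

Lemma one_seriesP u : val u [::] = 1. Proof. exact: eqP (valP u). Qed.

Lemma mulS0E f g : (f * g) [::] = f [::] * g [::].
Proof. by rewrite mulSE big_ord1. Qed.

Lemma expS_small x m w : x [::] = 0 -> (size w < m)%N -> (x ^+ m) w = 0.
Proof.
move=> x0; elim: m w => // m IHm w lt_wm; rewrite exprS mulSE big1 // => i _.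
have [->|i_gt0] := posnP i; first by rewrite take0 x0 mul0r.
rewrite IHm ?mulr0 // size_drop.
case: w lt_wm i i_gt0 => [|j w] /= lt_wm [[|i] lt_i] //= _.
by rewrite subSS (leq_ltn_trans (leq_subr _ _)).
Qed.

(* 1/f = \sum_m (1 - f)^m *)
Definition inv_series f : series n A :=
  fun w => \sum_(m < (size w).+1) ((1 - f) ^+ m) w.

Lemma inv_seriesE f w N : f [::] = 1 -> (size w <= N)%N ->
  inv_series f w = (\sum_(m < N.+1) (1 - f) ^+ m) w.
Proof.
move=> f1 le_wN; rewrite sumSE /inv_series.
rewrite (big_ord_widen N.+1 (fun m => ((1 - f) ^+ m) w)) ?ltnS //.
rewrite big_mkcond; apply: eq_bigr => i _; case: ltnP => // lt_wi.
by rewrite expS_small // addSE oppSE oneSE f1 subrr.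
Qed.

Lemma mulVS f : f [::] = 1 -> inv_series f * f = 1.
Proof.
move=> f1; apply/funext => w; set y := 1 - f.
have y0 : y [::] = 0 by rewrite /y addSE oppSE oneSE f1 subrr.
have -> : (inv_series f * f) w = ((\sum_(m < (size w).+1) y ^+ m) * f) w.
  rewrite !mulSE; apply: eq_bigr => i _; rewrite (@inv_seriesE f _ (size w)) //.
  by rewrite size_take_min geq_minr.
have -> : (\sum_(m < (size w).+1) y ^+ m) * f = 1 - y ^+ (size w).+1.
  have -> : f = - (y - 1) by rewrite /y opprB subKr.
  have cy : GRing.comm (y - 1) (\sum_(m < (size w).+1) y ^+ m).
    apply: commr_sum => i _; apply/commrX/commr_sym.
    by apply: commrB => //; apply: commr1.
  by rewrite mulrN -cy -subrX1 opprB.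
by rewrite addSE oppSE expS_small // oppr0 addr0.
Qed.

Lemma mulSV f : f [::] = 1 -> f * inv_series f = 1.
Proof.
move=> f1; apply/funext => w; set y := 1 - f.
have y0 : y [::] = 0 by rewrite /y addSE oppSE oneSE f1 subrr.
have -> : (f * inv_series f) w = (f * (\sum_(m < (size w).+1) y ^+ m)) w.
  rewrite !mulSE; apply: eq_bigr => i _; rewrite (@inv_seriesE f _ (size w)) //.
  by rewrite size_drop leq_subr.
have -> : f * (\sum_(m < (size w).+1) y ^+ m) = 1 - y ^+ (size w).+1.
  have -> : f = - (y - 1) by rewrite /y opprB subKr.
  by rewrite mulNr -subrX1 opprB.
by rewrite addSE oppSE expS_small // oppr0 addr0.
Qed.

Let one1 : (1 : series n A) [::] == 1. Proof. by []. Qed.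
Let mul1 u v : ((u : series n A) * (v : series n A)) [::] == 1.
Proof. by rewrite mulS0E !one_seriesP mulr1. Qed.
Let inv1 u : inv_series u [::] == 1.
Proof. by rewrite /inv_series big_ord1 expr0. Qed.

Let oneO := OneSeries one1.
Let mulO u v := OneSeries (mul1 u v).
Let invO u := OneSeries (inv1 u).

Let mulOA : associative mulO.
Proof. by move=> u v w; apply: val_inj; rewrite /= mulrA. Qed.
Let mul1O : left_id oneO mulO.
Proof. by move=> u; apply: val_inj; rewrite /= mul1r. Qed.
Let mulO1 : right_id oneO mulO.
Proof. by move=> u; apply: val_inj; rewrite /= mulr1. Qed.
Let mulVO : left_inverse oneO invO mulO.
Proof. by move=> u; apply: val_inj; rewrite /= mulVS ?one_seriesP. Qed.
Let mulOV : right_inverse oneO invO mulO.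
Proof. by move=> u; apply: val_inj; rewrite /= mulSV ?one_seriesP. Qed.

HB.instance Definition _ :=
  isGroup.Build one_series mulOA mul1O mulO1 mulVO mulOV.

Lemma val_mulO u v : val (u * v)%g = val u * val v. Proof. by []. Qed.
Lemma val_oneO : val (1%g : one_series) = 1. Proof. by []. Qed.

Let omega1 j : (1 + omega j : series n A) [::] == 1.
Proof. by rewrite addSE oneSE /omega /= addr0. Qed.

Definition one_plus_omega j : one_series := OneSeries (omega1 j).

End OneSeries.

Arguments one_plus_omega {n A} j.

Section Lyndon.
Variable n : nat.
Implicit Types u v w : word n.

Definition lex_le u v : bool := ((u : seqlexi 'I_n) <= (v : seqlexi 'I_n))%O.
Definition lex_lt u v : bool := ((u : seqlexi 'I_n) < (v : seqlexi 'I_n))%O.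

Definition lyndon w : bool :=
  (w != [::]) && [forall i : 'I_(size w), (0 < i)%N ==> lex_lt w (drop i w)].

Definition lyndon_word := {w : word n | lyndon w}.

(* reflexive form of the order that compares lengths first *)
Definition deglex_le u v : bool :=
  (size u < size v)%N || (size u == size v) && lex_le u v.

Definition words_upto m : seq (word n) :=
  [seq tval t | k <- iota 0 m.+1, t <- enum {: k.-tuple 'I_n}].

Definition lyndon_upto m : seq lyndon_word :=
  sort (fun L M => deglex_le (val L) (val M)) (pmap insub (words_upto m)).

Lemma mem_words_upto m w : (w \in words_upto m) = (size w <= m)%N.
Proof.
apply/allpairsPdep/idP => [[k [t [+ _ ->]]]|le_wm].
  by rewrite mem_iota size_tuple.
by exists (size w), (in_tuple w); rewrite mem_iota mem_enum.
Qed.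

Lemma words_upto_uniq m : uniq (words_upto m).
Proof.
apply: allpairs_uniq_dep; first exact: iota_uniq.
  by move=> k _; apply: enum_uniq.
move=> [k t] [l s] _ _ /= eq_ts; have eq_kl : k = l.
  by rewrite -(size_tuple t) eq_ts size_tuple.
by case: l / eq_kl s eq_ts => s /val_inj ->.
Qed.

Lemma mem_lyndon_upto m (L : lyndon_word) :
  (L \in lyndon_upto m) = (size (val L) <= m)%N.
Proof. by rewrite mem_sort mem_pmap_sub mem_words_upto. Qed.

Lemma lyndon_upto_uniq m : uniq (lyndon_upto m).
Proof. by rewrite sort_uniq pmap_sub_uniq // words_upto_uniq. Qed.

Lemma lyndon_upto_sorted m :
  sorted (fun L M => deglex_le (val L) (val M)) (lyndon_upto m).
Proof.
apply: sort_sorted => L M; move: (val L) (val M) => u v; rewrite /deglex_le /lex_le /=.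
by case: (ltngtP (size u) (size v)) => //= _; apply: le_total.
Qed.

(* position at which the longest proper Lyndon suffix starts *)
Definition lyndon_cut w : nat :=
  (find (fun i => lyndon (drop i.+1 w)) (iota 0 (size w).-1)).+1.

Lemma lyndon_cutP w : (1 < size w)%N ->
  [/\ (0 < lyndon_cut w < size w)%N, lyndon (drop (lyndon_cut w) w) &
      forall i, (0 < i < lyndon_cut w)%N -> ~~ lyndon (drop i w)].
Proof.
move=> w_gt1; rewrite /lyndon_cut; set a := fun i => lyndon (drop i.+1 w).
have w_gt0 := ltnW w_gt1.
have has_a : has a (iota 0 (size w).-1).
  apply/hasP; exists (size w).-2.
    by rewrite mem_iota /= add0n; case: (size w) w_gt1 => [|[]].
  have size1 : size (drop (size w).-2.+1 w) = 1%N.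
    by rewrite size_drop; case: (size w) w_gt1 => [|[|k]] //=; rewrite subSnn.
  rewrite /a /lyndon -size_eq0 size1; apply/forallP => i.
  by case: i => [[|i]] /=; rewrite ?size1.
have := has_a; rewrite has_find size_iota => lt_f.
split; first by rewrite /= -(ltn_predK w_gt1) ltnS.
  by have := nth_find 0%N has_a; rewrite nth_iota // add0n.
move=> [|i] //=; rewrite ltnS => lt_if.
have := before_find 0%N lt_if; rewrite nth_iota ?(ltn_trans lt_if) //.
by rewrite add0n /a => ->.
Qed.

Variable G : groupType.

(* The recursion is on the length [k] of [L]; [[~ a, b]] is
   [a^-1 * b^-1 * a * b]. *)
Fixpoint Xi_rec (k : nat) (g : 'I_n -> G) (L : word n) : G :=
  match k, L with
  | 0, _ => 1%g
  | _, [:: j] => g j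
  | k'.+1, _ => [~ Xi_rec k' g (take (lyndon_cut L) L),
                   Xi_rec k' g (drop (lyndon_cut L) L)]%g
  end.

Definition Xi (g : 'I_n -> G) (L : word n) : G := Xi_rec (size L) g L.

Lemma Xi_letter g j : Xi g [:: j] = g j.
Proof. by []. Qed.

Let Xi_recS k g L : (1 < size L)%N ->
  Xi_rec k.+1 g L = [~ Xi_rec k g (take (lyndon_cut L) L),
                       Xi_rec k g (drop (lyndon_cut L) L)]%g.
Proof. by case: L => [|j [|j' L]]. Qed.

Let take_cut L : (1 < size L)%N -> (0 < size (take (lyndon_cut L) L) < size L)%N.
Proof.
by move=> /lyndon_cutP[/andP[c_gt0 lt_c] _ _]; rewrite size_takel ?(ltnW lt_c) ?c_gt0.
Qed.

Let drop_cut L : (1 < size L)%N -> (0 < size (drop (lyndon_cut L) L) < size L)%N.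
Proof.
move=> /lyndon_cutP[/andP[c_gt0 lt_c] _ _]; rewrite size_drop subn_gt0 lt_c.
by rewrite ltn_subrL c_gt0 (leq_ltn_trans _ lt_c).
Qed.

Let Xi_recE k g L : (0 < size L <= k)%N -> Xi_rec k g L = Xi g L.
Proof.
have [b le_kb] : exists b, (k <= b)%N by exists k.
elim: b k L le_kb => [|b IHb] k L le_kb /andP[L_gt0 le_Lk].
  by have := leq_trans L_gt0 (leq_trans le_Lk le_kb).
have [L_gt1|L_le1] := ltnP 1 (size L); last first.
  by move: L_gt0 L_le1 le_Lk; case: k {le_kb} => [|k]; case: L => [|j []].
rewrite /Xi; case eqL : (size L) L_gt1 => [|l] // L_gt1.
case: k le_kb le_Lk => [|k] le_kb le_Lk; first by rewrite eqL in le_Lk.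
rewrite -eqL in L_gt1; have le_lk : (l <= k)%N by rewrite eqL in le_Lk.
have [/andP[t_gt0 lt_t] /andP[d_gt0 lt_d]] := (take_cut L_gt1, drop_cut L_gt1).
rewrite eqL !ltnS in lt_t lt_d; rewrite !Xi_recS // ltnS in le_kb *.
have le_lb := leq_trans le_lk le_kb.
by rewrite (IHb k) ?t_gt0 ?(leq_trans lt_t) // (IHb k) ?d_gt0 ?(leq_trans lt_d) //
           (IHb l) ?t_gt0 // (IHb l) ?d_gt0.
Qed.

Lemma Xi_split g L : (1 < size L)%N ->
  Xi g L = [~ Xi g (take (lyndon_cut L) L), Xi g (drop (lyndon_cut L) L)]%g.
Proof.
move=> L_gt1; have [t_size d_size] := (take_cut L_gt1, drop_cut L_gt1).
rewrite {1}/Xi; case eqL : (size L) L_gt1 t_size d_size => [|l] // L_gt1.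
rewrite !ltnS => t_size d_size; rewrite Xi_recS ?eqL // !Xi_recE //.
Qed.

End Lyndon.

Section Power.
Variables (n : nat) (E : comPzRingType) (ratE : {rmorphism rat -> E}).

(* t (t - 1) ... (t - m + 1) / m! *)
Definition binom_coef (t : E) (m : nat) : E :=
  ratE (m`!%:R^-1) * \prod_(i < m) (t - i%:R).

(* (1 + x)^t, for x without constant term: see [pow_series_cvg] *)
Definition pow_series (x : series n E) (t : E) : series n E :=
  fun w => \sum_(m < (size w).+1) binom_coef t m * (x ^+ m) w.

End Power.

Section Delta.
Variables (n : nat) (E : comPzRingType).
Implicit Types (f g : series n E) (a b w : word n).

(* [h : series2] is the series with coefficient [h a b] at
   omega^a (x) omega^b.  The product of [series n (series n E)], in which the
   left variables commute with the coefficients, is the factorwise one. *)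
Definition series2 := series n (series n E).

Definition tensor f g : series2 := fun a b => f a * g b.

Definition delta_letter (j : 'I_n) : series2 :=
  tensor (omega j) 1 + tensor 1 (omega j) + tensor (omega j) (omega j).

Definition delta_word w : series2 := \prod_(j <- w) delta_letter j.

(* \sum_w f w . delta (omega^w); only words of length at most |a| + |b|
   contribute to the coefficient at (a, b) *)
Definition delta f : series2 :=
  fun a b => \sum_(w <- words_upto n (size a + size b)) f w * delta_word w a b.

Lemma mul2E (h k : series2) a b :
  (h * k) a b = \sum_(i < (size a).+1) \sum_(j < (size b).+1)
    h (take i a) (take j b) * k (drop i a) (drop j b).
Proof. by rewrite mulSE sumSE; apply: eq_bigr => i _; rewrite mulSE. Qed.

Lemma delta_word_cat u v : delta_word (u ++ v) = delta_word u * delta_word v.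
Proof. by rewrite /delta_word big_cat. Qed.

Lemma delta_word_small w a b :
  (size a + size b < size w)%N -> delta_word w a b = 0.
Proof.
elim: w a b => // j w IHw a b; rewrite ltnS => le_w.
rewrite -cat1s delta_word_cat mul2E big1 // => i _; rewrite big1 // => k _.
have [ab0|ab_gt0] := posnP (size (take i a) + size (take k b)).
  move/eqP: ab0; rewrite addn_eq0 !size_eq0 => /andP[/eqP-> /eqP->].
  rewrite /delta_word big_seq1 /delta_letter !addSE /tensor /omega /= !oneSE.
  by rewrite !(mulr0n, mul0r, mulr0, addr0).
rewrite IHw ?mulr0 //; apply: leq_trans le_w.
have := congr1 size (cat_take_drop i a); have := congr1 size (cat_take_drop k b).
rewrite !size_cat; move: ab_gt0 {IHw}; move: (nat_of_ord i) (nat_of_ord k) => c d.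
move=> cd_gt0 <- <-; rewrite addnACA.
by rewrite -[X in (X < _)%N]add0n ltn_add2r.
Qed.

Lemma sum_words_upto (V : nmodType) (F : word n -> V) N M : (N <= M)%N ->
  (forall w, (N < size w)%N -> F w = 0) ->
  \sum_(w <- words_upto n M) F w = \sum_(w <- words_upto n N) F w.
Proof.
move=> le_NM F0; rewrite (bigID (fun w => size w <= N)%N) /= [X in _ + X]big1.
  rewrite addr0 -big_filter; apply/perm_big/uniq_perm.
  - exact/filter_uniq/words_upto_uniq.
  - exact: words_upto_uniq.
  move=> w; rewrite mem_filter !mem_words_upto andb_idr // => le_w.
  exact: leq_trans le_NM.
by move=> w; rewrite -ltnNge => /F0.
Qed.

Lemma delta_widen f a b N : (size a + size b <= N)%N ->
  delta f a b = \sum_(w <- words_upto n N) f w * delta_word w a b.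
Proof.
move=> le_N; rewrite (sum_words_upto le_N) // => w lt_w.
by rewrite delta_word_small ?mulr0.
Qed.

Let deltaB f g : delta (f - g) = delta f - delta g.
Proof.
apply/funext => a; apply/funext => b.
rewrite !addSE !oppSE /delta -sumrB; apply: eq_bigr => w _.
by rewrite addSE oppSE mulrBl.
Qed.

Lemma sum_splits (V : nmodType) (F : word n -> word n -> V) N :
  (forall u v, (N < size u + size v)%N -> F u v = 0) ->
  \sum_(u <- words_upto n N) \sum_(v <- words_upto n N) F u v =
  \sum_(w <- words_upto n N) \sum_(i < (size w).+1) F (take i w) (drop i w).
Proof.
move=> F0; pose G (p : word n * word n) := F p.1 p.2.
pose cuts w := iota 0 (size w).+1.
have -> : \sum_(u <- words_upto n N) \sum_(v <- words_upto n N) F u v =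
    \sum_(p <- [seq (u, v) | u <- words_upto n N, v <- words_upto n N]) G p.
  by rewrite [RHS]big_allpairs_dep.
have -> : \sum_(w <- words_upto n N) \sum_(i < (size w).+1)
      F (take i w) (drop i w) =
    \sum_(p <- [seq (take i w, drop i w) | w <- words_upto n N, i <- cuts w]) G p.
  rewrite [RHS]big_allpairs_dep; apply: eq_bigr => w _.
  by rewrite -[cuts w]/(index_iota 0 (size w).+1) big_mkord.
have uniq_cuts w : uniq (cuts w) by apply: iota_uniq.
have mem_cuts w i : (i \in cuts w) = (i <= size w)%N by rewrite mem_iota.
clearbody cuts; rewrite (bigID (fun p => size p.1 + size p.2 <= N)%N) /= [X in _ + X]big1.
  rewrite addr0 -big_filter; apply/perm_big/uniq_perm.
  - apply/filter_uniq/allpairs_uniq; try exact: words_upto_uniq.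
    by move=> [u v] [u' v'] _ _ /=.
  - refine (@allpairs_uniq_dep _ (fun=> nat) _ (fun (w : word n) i => (take i w, drop i w)) (words_upto n N) cuts _ _ _).
    - exact: words_upto_uniq.
    - by [].
    move=> [w i] [w' i'] /allpairsPdep[x [k [_ + [-> ->]]]].
    move=> + /allpairsPdep[x' [k' [_ + [-> ->]]]] /= => {w i w' i'}.
    rewrite !mem_cuts => le_k le_k' [eq_t eq_d].
    have eq_x : x = x' by rewrite -(cat_take_drop k x) eq_t eq_d cat_take_drop.
    rewrite -eq_x in le_k' eq_t *; congr Tagged.
    by rewrite -(size_takel le_k) eq_t size_takel.
  move=> [u v]; rewrite mem_filter /=; apply/andP/idP => [[le_N _]|].
    apply/flatten_mapP; exists (u ++ v); first by rewrite mem_words_upto size_cat.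
    apply/mapP; exists (size u); last by rewrite take_size_cat ?drop_size_cat.
    by rewrite mem_cuts size_cat leq_addr.
  case/flatten_mapP => w; rewrite mem_words_upto => le_w /mapP[i _ [-> ->]].
  rewrite -size_cat cat_take_drop; split=> //.
  apply/allpairsP; exists (take i w, drop i w); rewrite !mem_words_upto /=.
  rewrite size_take_min size_drop (leq_trans (geq_minr _ _)) //.
  by rewrite (leq_trans (leq_subr _ _)).
by move=> p; rewrite -ltnNge => /F0.
Qed.

Let deltaM f g : delta (f * g) = delta f * delta g.
Proof.
apply/funext => a; apply/funext => b; rewrite mul2E {1}/delta.
set N := (size a + size b)%N.
pose F u v := f u * g v * delta_word (u ++ v) a b.
transitivity (\sum_(w <- words_upto n N) \sum_(i < (size w).+1)
                 F (take i w) (drop i w)).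
  apply: eq_bigr => w _; rewrite mulSE mulr_suml; apply: eq_bigr => i _.
  by rewrite /F cat_take_drop.
rewrite -sum_splits => [|u v lt_N]; last first.
  by rewrite /F delta_word_small ?mulr0 // size_cat.
pose H i j u v := f u * g v * (delta_word u (take i a) (take j b) *
                                 delta_word v (drop i a) (drop j b)).
transitivity (\sum_(i < (size a).+1) \sum_(j < (size b).+1)
    \sum_(u <- words_upto n N) \sum_(v <- words_upto n N) H i j u v).
  under [RHS]eq_bigr do rewrite exchange_big.
  rewrite [RHS]exchange_big; apply: eq_bigr => u _ /=.
  under [RHS]eq_bigr do rewrite exchange_big.
  rewrite [RHS]exchange_big; apply: eq_bigr => v _ /=.
  rewrite /F delta_word_cat mul2E mulr_sumr; apply: eq_bigr => i _.
  by rewrite mulr_sumr.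
apply: eq_bigr => i _; apply: eq_bigr => j _.
rewrite !(@delta_widen _ _ _ N) //; first last.
- by rewrite leq_add // size_take_min geq_minr.
- by rewrite leq_add // size_drop leq_subr.
rewrite mulr_suml; apply: eq_bigr => u _; rewrite mulr_sumr.
by apply: eq_bigr => v _; rewrite /H mulrACA.
Qed.

Lemma delta_const c : delta (const_series c) = const_series (const_series c).
Proof.
apply/funext => a; apply/funext => b; rewrite /delta.
rewrite (bigD1_seq [::]) ?mem_words_upto ?words_upto_uniq //= big1 => [|w]; last first.
  by case: w => //= j w _; rewrite mul0r.
rewrite addr0 /delta_word big_nil oneSE.
by case: a b => [|? ?] [|? ?] /=; rewrite ?oneSE ?mulr1 ?mulr0.
Qed.

Let delta1 : delta 1 = 1. Proof. exact: delta_const. Qed.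

HB.instance Definition _ :=
  GRing.isZmodMorphism.Build (series n E) series2 delta deltaB.
HB.instance Definition _ :=
  GRing.isMonoidMorphism.Build (series n E) series2 delta (delta1, deltaM).

Lemma delta_omega j : delta (omega j) =
  tensor (omega j) 1 + tensor 1 (omega j) + tensor (omega j) (omega j).
Proof.
apply/funext => a; apply/funext => b; rewrite (delta_widen _ (leqnSn _)).
rewrite (bigD1_seq [:: j]) ?mem_words_upto ?words_upto_uniq //= big1 => [|w].
  by rewrite addr0 /omega eqxx mul1r /delta_word big_seq1.
by move=> /negbTE w_j; rewrite /omega w_j mul0r.
Qed.

End Delta.

Section SeriesTopology.
Variables (n : nat) (A : topologicalType).

Lemma series_cvgP (F : set_system (series n A)) (f : series n A) :
  Filter F -> (F --> f) <-> (forall w, (fun g : series n A => g w) @ F --> f w).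
Proof.
move=> FF; split=> [Ff w|Ff].
  apply: cvg_trans (@proj_continuous _ (fun _ : word n => A) w f).
  exact: cvg_app.
apply/cvg_sup => w; apply/cvg_image; last first.
  by move=> U /Ff /= FU; exists ((fun g : series n A => g w) @^-1` U) => //;
     rewrite eqEsubset; split=> [_ [g Ug <-]|a Ua] //; exists (fun=> a).
by rewrite eqEsubset; split=> // a _; exists (fun=> a).
Qed.

Lemma series_hausdorff : hausdorff_space A -> hausdorff_space (series n A).
Proof. by move=> hA; apply: (@hausdorff_product _ (fun _ : word n => A)). Qed.

Lemma coef_continuous w : continuous (fun g : series n A => g w).
Proof. exact: (@proj_continuous _ (fun _ : word n => A) w). Qed.

End SeriesTopology.

Section TopologicalFacts.
Variables (n : nat) (E : topComRingType) (ratE : {rmorphism rat -> E}).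
Implicit Types (f g x : series n E) (t : E) (w : word n).

Lemma pow_series_cvg x t : x [::] = 0 ->
  (fun N => \sum_(m < N) const_series (binom_coef ratE t m) * x ^+ m) @ \oo -->
    pow_series ratE x t.
Proof.
move=> x0; apply/series_cvgP => w; apply: cvg_near_cst.
exists (size w).+1 => // N /= lt_wN; rewrite sumSE /pow_series.
rewrite (big_ord_widen N (fun m => binom_coef ratE t m * (x ^+ m) w)) //.
rewrite [RHS]big_mkcond; apply: eq_bigr => i _.
rewrite mulSE big_ord_recl /= take0 drop0 big1 ?addr0 => [|j _].
  by case: ltnP => // lt_wi; rewrite expS_small ?mulr0.
by case: w {lt_wN} j => [|a w] [] //= j _; rewrite mul0r.
Qed.

Lemma delta_continuous : continuous (@delta n E).
Proof.
move=> f; apply/series_cvgP; first exact/fmap_filter/nbhs_filter.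
move=> a; apply/series_cvgP; first exact/fmap_filter/fmap_filter/nbhs_filter.
move=> b.
suff key (s : seq (word n)) :
    (fun x : series n E => \sum_(w <- s) x w * delta_word E w a b) @ f -->
    \sum_(w <- s) f w * delta_word E w a b by exact: key.
have Ff : Filter (nbhs f) := nbhs_filter f.
elim: s => [|w s IHs].
  under eq_fun do rewrite big_nil.
  rewrite big_nil. exact: cvg_cst.
under eq_fun do rewrite big_cons.
rewrite big_cons.
have cvg_w : (fun x : series n E => x w * delta_word E w a b) @ f -->
    f w * delta_word E w a b.
  apply: (cvg_comp2 _ _ (@mul_continuous E (f w, delta_word E w a b))).
    exact: coef_continuous.
  exact: cvg_cst.
exact: (cvg_comp2 cvg_w IHs (@add_continuous E (_, _))).
Qed.

(* [delta] is the only continuous morphism of E-algebras with these values *)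
Lemma delta_unique (phi : {rmorphism series n E -> series2 n E}) :
  hausdorff_space E -> continuous phi ->
  (forall c, phi (const_series c) = const_series (const_series c)) ->
  (forall j, phi (omega j) =
    tensor (omega j) 1 + tensor 1 (omega j) + tensor (omega j) (omega j)) ->
  phi =1 @delta n E.
Proof.
move=> hE phi_cont phi_const phi_omega f.
pose mono w : series n E := \prod_(j <- w) omega j.
have monoE w v : mono w v = (v == w)%:R.
  elim: w v => [|j w IHw] v; first by rewrite /mono big_nil oneSE.
  rewrite /mono big_cons -/(mono w); case: v => [|i v].
    by rewrite mulS0E mul0r.
  rewrite mulSE big_ord_recl /= mul0r add0r big_ord_recl /= drop0 take0 IHw.
  rewrite big1 ?addr0 => [|k _]; last first.
    case: v k => [[]|a v] // k.
    by rewrite /omega /= eqseq_cons andbF mul0r.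
  rewrite /omega !eqseq_cons andbT.
  by case: (i == j); rewrite ?mul1r ?mul0r.
pose trunc N := \sum_(w <- words_upto n N) const_series (f w) * mono w.
have truncE N v : (size v <= N)%N -> trunc N v = f v.
  move=> le_v; rewrite /trunc sumSE (bigD1_seq v) ?words_upto_uniq ?mem_words_upto //=.
  have cE c w : (const_series c * mono w) v = c * mono w v.
    rewrite mulSE big_ord_recl /= take0 drop0 big1 ?addr0 // => j _.
    by case: v {le_v} j => [|a v] [] //= j _; rewrite mul0r.
  rewrite cE monoE eqxx mulr1 big1 ?addr0 // => w w_v.
  by rewrite cE monoE eq_sym (negbTE w_v) mulr0.
have trunc_cvg : trunc @ \oo --> f.
  apply/series_cvgP => v; apply: cvg_near_cst.
  by exists (size v) => // N /= /truncE.
have phi_trunc N : phi (trunc N) = delta (trunc N).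
  rewrite !rmorph_sum; apply: eq_bigr => w _.
  rewrite !rmorphM /= phi_const delta_const !rmorph_prod.
  by congr (_ * _); apply: eq_bigr => j _; rewrite /= phi_omega delta_omega.
have h2 : hausdorff_space (series2 n E).
  exact/series_hausdorff/series_hausdorff.
have cvg1 : (phi \o trunc) @ \oo --> phi f.
  exact: cvg_comp trunc_cvg (phi_cont f).
have cvg2 : (phi \o trunc) @ \oo --> delta f.
  have -> : phi \o trunc = @delta n E \o trunc by apply/funext => N /=.
  exact: cvg_comp trunc_cvg (@delta_continuous f).
exact: (cvg_unique h2 cvg1 cvg2).
Qed.

End TopologicalFacts.

Definition Fr (n : nat) (E : comPzRingType) : set (series n E) :=
  [set g | g [::] = 1 /\ delta g = tensor g g].
Arguments Fr : clear implicits.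

Definition Fr_coefs (n : nat) (E : comPzRingType) (S : set E) :
    set (series n E) :=
  Fr n E `&` [set g | forall w, S (g w)].
Arguments Fr_coefs n {E} S.

Section LyndonProduct.
Variables (n : nat) (E : topComRingType) (ratE : {rmorphism rat -> E}).

(* the ordered product of Xi_L (1 + omega_1, ..., 1 + omega_n) ^ t_L over the
   Lyndon words L of length at most [m] *)
Definition lyndon_prod (t : lyndon_word n -> E) (m : nat) : series n E :=
  \prod_(L <- lyndon_upto n m)
    pow_series ratE (val (Xi one_plus_omega (val L)) - 1) (t L).

(* [g] is the infinite product.  The words of length at most [m] form an initial
   segment, so the [lyndon_prod t m] are cofinal among the partial products. *)
Definition lyndon_expansion (t : lyndon_word n -> E) (g : series n E) : Prop :=
  lyndon_prod t m @[m --> \oo] --> g.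

End LyndonProduct.

(* Main.v *)
Require Import Defs.
From mathcomp Require Import all_boot all_order all_algebra.
From mathcomp Require Import boolp classical_sets functions reals topology tvs.
From mathcomp Require Import zify.

(** The coefficient of [delta (omega^u)] at [(a, b)] is the coefficient of [u]
    in the infiltration product of [a] and [b]; for [|u| = |a| + |b|] it counts
    the ways to shuffle [a] and [b] into [u].  A non-Lyndon word [w] can be cut
    as [w = a b] with [w] the largest shuffle of [a] and [b], so the group-like
    condition [g(a) g(b) = delta(g)(a, b)] determines [g(w)] from the smaller
    coefficients: a group-like series is determined by its coefficients at
    Lyndon words.  On the other hand [Xi_L - 1] starts in degree [|L|] with [L]
    plus lexicographically larger words, so the coefficient at [L] of the
    ordered product is [t_L] plus an expression in the exponents of the smaller
    Lyndon words, which takes values in any subring containing these exponents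
    and closed under binomial coefficients.  Hence the exponents can be read off
    recursively from [g], within [Z] or its closure when the coefficients of [g]
    lie there. *)

Set Implicit Arguments.
Unset Strict Implicit.
Unset Printing Implicit Defensive.

Import Order.TTheory GRing.Theory Num.Theory.

Local Open Scope classical_set_scope.
Local Open Scope ring_scope.

(** * The lexicographic order and Lyndon words *)

Section Lex.
Variable n : nat.
Implicit Types (x y : 'I_n) (a b p s t u v w z : word n).

Lemma lex_le_refl u : lex_le u u. Proof. exact: lexx. Qed.

Lemma lex_le_trans v u w : lex_le u v -> lex_le v w -> lex_le u w.
Proof. exact: le_trans. Qed.

Lemma lex_lt_le_trans v u w : lex_lt u v -> lex_le v w -> lex_lt u w.
Proof. exact: lt_le_trans. Qed.

Lemma lex_lt_trans v u w : lex_lt u v -> lex_lt v w -> lex_lt u w.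
Proof. exact: lt_trans. Qed.

Lemma lex_ltW u v : lex_lt u v -> lex_le u v. Proof. exact: ltW. Qed.

Lemma lex_leNlt u v : lex_le u v = ~~ lex_lt v u. Proof. exact: leNgt. Qed.

Lemma lex_ltNle u v : lex_lt u v = ~~ lex_le v u. Proof. exact: ltNge. Qed.

Lemma lex_lt_neqAle u v : lex_lt u v = (u != v) && lex_le u v.
Proof. exact: lt_neqAle. Qed.

Lemma lex_le_anti u v : lex_le u v -> lex_le v u -> u = v.
Proof. by move=> uv vu; apply: (@le_anti _ (seqlexi 'I_n)); apply/andP. Qed.

Lemma lex_ltxx u : lex_lt u u = false. Proof. exact: ltxx. Qed.

Lemma lex_le_cons x y u v :
  lex_le (x :: u) (y :: v) = (x < y)%N || (x == y) && lex_le u v.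
Proof.
by rewrite /lex_le [LHS]lexi_cons !leEord -val_eqE /=; case: ltngtP.
Qed.

Lemma lex_lt_cons x y u v :
  lex_lt (x :: u) (y :: v) = (x < y)%N || (x == y) && lex_lt u v.
Proof.
rewrite !lex_ltNle lex_le_cons negb_or negb_and -leqNgt [y == x]eq_sym -val_eqE
  /=.
by case: ltngtP.
Qed.

Lemma lex_le_catl p u v : lex_le (p ++ u) (p ++ v) = lex_le u v.
Proof. by elim: p => //= x p IHp; rewrite lex_le_cons ltnn eqxx IHp. Qed.

Lemma lex_lt_catl p u v : lex_lt (p ++ u) (p ++ v) = lex_lt u v.
Proof. by rewrite !lex_ltNle lex_le_catl. Qed.

Lemma lex_le_prefix p u : lex_le p (p ++ u).
Proof. by rewrite -{1}[p]cats0 lex_le_catl. Qed.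

(** The comparison is already decided at a letter present in both [u] and [v], so appended words do
    not matter. *)
Lemma lex_lt_cat u v s t :
  ~~ prefix u v -> lex_lt u v -> lex_lt (u ++ s) (v ++ t).
Proof.
elim: u v => [|x u IHu] [|y v] //=; rewrite !lex_lt_cons => Npre.
move=> /orP[-> //|/andP[/eqP eq_xy lt_uv]]; subst y.
by rewrite ltnn eqxx /= IHu //; move: Npre; rewrite eqxx.
Qed.

Lemma lex_lt_cat_size u v s t :
  (size v <= size u)%N -> lex_lt u v -> lex_lt (u ++ s) (v ++ t).
Proof.
move=> le_vu lt_uv; apply: lex_lt_cat => //; apply/negP => /prefixP[r def_v].
case: r def_v => [|x r] def_v; first by rewrite def_v cats0 lex_ltxx in lt_uv.
by move: le_vu; rewrite def_v size_cat /= -{2}[size u]addn0 leq_add2l.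
Qed.

Lemma lex_le_cat u v s t : size u = size v ->
  lex_le u v -> lex_le s t -> lex_le (u ++ s) (v ++ t).
Proof.
move=> eq_uv le_uv le_st; have [->|neq_uv] := eqVneq u v.
  by rewrite lex_le_catl.
by apply/lex_ltW/lex_lt_cat_size; rewrite ?eq_uv // lex_lt_neqAle neq_uv.
Qed.

Lemma lyndon_lt_drop w i : lyndon w -> (0 < i < size w)%N -> lex_lt w (drop i
  w).
Proof.
move=> /andP[_ /forallP w_lyn] /andP[i_gt0 lt_i].
by have /implyP := w_lyn (Ordinal lt_i); apply.
Qed.

Lemma lyndonP w : w != [::] ->
  (forall i, (0 < i < size w)%N -> lex_lt w (drop i w)) -> lyndon w.
Proof.
move=> w0 w_lt; rewrite /lyndon w0; apply/forallP => i; apply/implyP => i_gt0.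
by rewrite w_lt // i_gt0 ltn_ord.
Qed.

Lemma lyndon_lt_cat u v : u != [::] -> v != [::] -> lyndon (u ++ v) ->
  lex_lt (u ++ v) v.
Proof.
move=> u0 v0 uv_lyn; rewrite -{2}[v](drop_size_cat _ (erefl (size u))).
by apply: lyndon_lt_drop => //;
  rewrite size_cat lt0n size_eq0 u0 -[X in (X < _)%N]addn0 ltn_add2l lt0n
  size_eq0.
Qed.

Lemma lyndon_size w : lyndon w -> (0 < size w)%N.
Proof. by case/andP; rewrite lt0n size_eq0. Qed.

(** First [u v < v]: this is decided inside [u] unless [v = u r], and then it reduces to [v < r],
    true for a proper suffix [r] of a Lyndon word. Any other proper suffix is a proper suffix of [u]
    followed by [v], or a proper suffix of [v]. *)
Lemma lyndon_cat u v : lyndon u -> lyndon v -> lex_lt u v -> lyndon (u ++ v).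
Proof.
move=> u_lyn v_lyn lt_uv.
have lt_v : lex_lt (u ++ v) v.
  have [/prefixP[r def_v]|Npre] := boolP (prefix u v); last first.
    by rewrite -[X in lex_lt _ X]cats0 lex_lt_cat.
  subst v; rewrite lex_lt_catl; apply: lyndon_lt_cat => //.
    by rewrite -size_eq0 -lt0n lyndon_size.
  by apply: contraTneq lt_uv => ->; rewrite cats0 lex_ltxx.
apply: lyndonP => [|i /andP[i_gt0]].
  by rewrite -size_eq0 size_cat -lt0n addn_gt0 lyndon_size.
rewrite size_cat => lt_i; rewrite drop_cat.
case: ltnP => [lt_iu|le_ui].
  by apply: lex_lt_cat_size;
    rewrite ?size_drop ?leq_subr ?lyndon_lt_drop ?i_gt0.
have [->|] := posnP (i - size u)%N; first by rewrite drop0.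
move=> j_gt0; apply: lex_lt_trans lt_v _; apply: lyndon_lt_drop => //.
by rewrite j_gt0 ltn_subLR.
Qed.

Lemma min_suffix w : w != [::] ->
  exists2 i, (i < size w)%N &
    forall j, (j < size w)%N -> lex_le (drop i w) (drop j w).
Proof.
elim: w => // x w IHw _; have [->|w0] := eqVneq w [::].
  by exists 0%N => // -[|j] //= _; rewrite lex_le_refl.
have [i lt_i min_i] := IHw w0.
have [le_i|] := boolP (lex_le (drop i w) (x :: w)).
  by exists i.+1 => // -[|j] //=; apply: min_i.
rewrite -lex_ltNle => lt_w; exists 0%N => // -[|j] /= lt_j;
  first exact: lex_le_refl.
exact/lex_ltW/(lex_lt_le_trans lt_w)/min_i.
Qed.

(** Suffixes of the smallest suffix are again suffixes of [w], and a proper one differs in length,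
    which makes the inequality strict. *)
Lemma lyndon_min_suffix w i : (i < size w)%N ->
  (forall j, (j < size w)%N -> lex_le (drop i w) (drop j w)) ->
  lyndon (drop i w).
Proof.
move=> lt_i min_i; apply: lyndonP => [|j];
  first by rewrite -size_eq0 size_drop -lt0n subn_gt0.
rewrite size_drop ltn_subRL => /andP[j_gt0 lt_ij];
  rewrite drop_drop lex_lt_neqAle addnC min_i // andbT.
apply/eqP => /(congr1 size)/eqP; rewrite !size_drop eqn_leq => /andP[+ _].
by rewrite leqNgt ltn_sub2l // -[X in (X < _)%N]addn0 ltn_add2l.
Qed.

(* With [w = v l], where [l] is the longest proper Lyndon suffix, and [s] the
   smallest suffix of [v], if [s <> v] then [w < l <= s < v <= w]. *)
Lemma lyndon_take_cut w : lyndon w -> (1 < size w)%N ->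
  lyndon (take (lyndon_cut w) w).
Proof.
move=> w_lyn w_gt1; have [/andP[c_gt0 lt_c] l_lyn l_longest] := lyndon_cutP
  w_gt1.
set c := lyndon_cut w in c_gt0 lt_c l_lyn l_longest *.
set v := take c w; set l := drop c w.
have size_v : size v = c by rewrite size_takel // ltnW.
have v0 : v != [::] by rewrite -size_eq0 size_v -lt0n.
have [i lt_i min_i] := min_suffix v0.
have s_lyn := lyndon_min_suffix lt_i min_i.
have [i0|i_gt0] := posnP i; first by rewrite i0 drop0 in s_lyn.
have le_ls : lex_le l (drop i v).
  (* If [s < l], then [s l] is a Lyndon proper suffix of [w] longer than [l]. *)
  rewrite lex_leNlt; apply/negP => /(lyndon_cat s_lyn l_lyn); apply/negP.
  have -> : drop i v ++ l = drop i w by rewrite -[w](cat_take_drop c) drop_cat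
    lt_i.
  by rewrite l_longest // i_gt0 -size_v.
have lt_wl : lex_lt w l by rewrite lyndon_lt_drop ?c_gt0.
have := lex_lt_le_trans lt_wl (lex_le_trans le_ls (min_i 0%N _)).
rewrite size_v c_gt0 drop0 => /(_ isT).
by rewrite lex_ltNle -{1}[w](cat_take_drop c) lex_le_prefix.
Qed.

End Lex.

(** * Infiltrations and shuffles *)

Section SeriesCoefficients.
Variables (n : nat) (A : pzRingType).
Implicit Types (f g h x : series n A) (c : A) (w : word n) (j : 'I_n).

Lemma const_mulSE c f w : (const_series c * f) w = c * f w.
Proof.
rewrite mulSE big_ord_recl /= take0 drop0 big1 ?addr0 // => i _.
by case: w i => [|? w] [] //= i _; rewrite mul0r.
Qed.

Lemma omega_mulSE j f w :
  (omega j * f) w = if w is x :: w' then (x == j)%:R * f w' else 0.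
Proof.
case: w => [|x w]; first by rewrite mulSE big_ord1 mul0r.
rewrite mulSE big_ord_recl mul0r add0r big_ord_recl /= take0 drop0 big1 ?addr0.
  by rewrite /omega eqseq_cons eqxx andbT.
move=> i _; rewrite /omega eqseq_cons; case: w i => [|y w] [i lt_i] //=.
by rewrite andbF mul0r.
Qed.

End SeriesCoefficients.

Section Infiltration.
Variable n : nat.
Implicit Types (a b u v w z : word n) (j x y : 'I_n).

(* the coefficient of [u] in the infiltration product of [a] and [b] *)
Fixpoint infil u a b : nat :=
  match u with
  | [::] => (a == [::]) && (b == [::])
  | j :: u' =>
      (if a is x :: a' then (x == j) * infil u' a' b else 0) +
      (if b is y :: b' then (y == j) * infil u' a b' else 0) +
      (if (a, b) is (x :: a', y :: b') then
         (x == j) * (y == j) * infil u' a' b' else 0)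
  end.

(** With [series2] read as series over series, [tensor (omega j) 1] is the variable and [tensor 1 f]
    a constant. Left multiplication by the three terms of [delta_letter] then strips a first letter
    [j] from [a], from [b], or from both. *)
Lemma infilE (E : comPzRingType) u a b : delta_word E u a b = (infil u a b)%:R.
Proof.
elim: u a b => [|j u IHu] a b.
  by rewrite /delta_word big_nil; case: a => [|x a]; case: b => [|y b].
rewrite /delta_word big_cons -/(delta_word E u) /delta_letter !mulrDl !addSE.
have -> : tensor (omega j : series n E) 1 = omega j :> series n (series n E).
  apply/funext => c; apply/funext => d; rewrite /tensor /omega.
  by case: (c == _); rewrite ?mul1r ?mul0r.
have -> (f : series n E) : tensor 1 f = const_series f :> series n (series n E).
  apply/funext => c; apply/funext => d; rewrite /tensor oneSE.
  by case: c => [|? ?]; rewrite ?mul1r ?mul0r.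
have -> : tensor (omega j) (omega j) =
    const_series (omega j : series n E) * omega j :> series n (series n E).
  apply/funext => c; apply/funext => d; rewrite const_mulSE /tensor /omega.
  by case: (c == _); rewrite ?mulr1 ?mulr0 ?mul1r ?mul0r.
have natM (m : bool) (f : series n E) d : (m%:R * f) d = m%:R * f d.
  by case: m; rewrite ?mul1r ?mul0r.
rewrite /= !natrD -mulrA !const_mulSE !omega_mulSE; congr (_ + _ + _).
- by case: a => [|x a] //; rewrite natM IHu natrM.
- by case: b => [|y b] //; rewrite IHu natrM.
- case: a b => [|x a] [|y b] //; rewrite ?mulr0 // natM IHu !natrM.
  by rewrite -mulrA mulrCA.
Qed.

Inductive shuffle : word n -> word n -> word n -> Prop :=
  | shuffle_nil : shuffle [::] [::] [::]
  | shuffle_left x u a b : shuffle u a b -> shuffle (x :: u) (x :: a) b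
  | shuffle_right x u a b : shuffle u a b -> shuffle (x :: u) a (x :: b).

Lemma shuffle_consP x u a b : shuffle (x :: u) a b ->
  (exists2 a', a = x :: a' & shuffle u a' b) \/
  (exists2 b', b = x :: b' & shuffle u a b').
Proof.
move=> sh_u; inversion sh_u; subst; first by left; exists a0.
by right; exists b0.
Qed.

Lemma shuffle_size u a b : shuffle u a b -> size u = (size a + size b)%N.
Proof. by elim=> // x {}u {}a {}b _ /= ->; rewrite ?addnS. Qed.

Lemma shuffle0 a : shuffle a [::] a.
Proof. by elim: a => [|x a IHa]; [exact: shuffle_nil|exact: shuffle_right]. Qed.

Lemma shuffle_cat a b : shuffle (a ++ b) a b.
Proof. by elim: a => [|x a IHa] /=; [exact: shuffle0|exact: shuffle_left]. Qed.

Lemma shuffle_l0 u a : shuffle u [::] a -> u = a.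
Proof.
elim: u a => [|x u IHu] a sh_u.
  by have /esym/eqP := shuffle_size sh_u; rewrite size_eq0 => /eqP.
by case: (shuffle_consP sh_u) => -[c // -> /IHu->].
Qed.

(** Each letter of [u] uses up a letter of [a], a letter of [b], or one of both. *)
Lemma infil_small u a b : (size a + size b < size u)%N -> infil u a b = 0%N.
Proof.
elim: u a b => // j u IHu [|x a] [|y b] //= lt_u; rewrite !IHu ?muln0 //=; lia.
Qed.

(** At full length, merging a letter of [a] with one of [b] leaves too few letters, so that term
    vanishes by [infil_small]. *)
Lemma infil_shuffle u a b : size u = (size a + size b)%N ->
  (0 < infil u a b)%N -> shuffle u a b.
Proof.
elim: u a b => [|j u IHu] a b; first by case: a b => [|? ?] [|? ?] // _ _;
  exact: shuffle_nil.
rewrite /= => size_u; rewrite !addn_gt0 -orbA => /or3P[].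
- case: a size_u => // x a [size_u]; rewrite muln_gt0 lt0b => /andP[/eqP-> lt0].
  exact/shuffle_left/IHu.
- case: b size_u => // y b; rewrite addnS => -[size_u].
  rewrite muln_gt0 lt0b => /andP[/eqP-> lt0]; exact/shuffle_right/IHu.
- case: a b size_u => [|x a] [|y b] //= [size_u].
  by rewrite infil_small ?muln0 // size_u addnS.
Qed.

Lemma shuffle_infil u a b : shuffle u a b -> (0 < infil u a b)%N.
Proof.
by elim=> [|x {}u {}a {}b _ IH|x {}u {}a {}b _ IH] //=;
  rewrite !addn_gt0 eqxx mul1n IH ?orbT.
Qed.

(* Exchange argument for the largest merge of two words.  The word [z] records
   how far the two readings [z a, b] and [a, z b] are apart. *)
Lemma shuffle_exchange u z a b : shuffle u (z ++ a) b -> lex_le b a ->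
  exists2 u', shuffle u' a (z ++ b) & lex_le u u'.
Proof.
elim: u z a b => [|x u IHu] z a b sh_u le_ba.
  have /esym/eqP := shuffle_size sh_u; rewrite size_cat !addn_eq0 !size_eq0.
  by case/andP=> /andP[/eqP-> /eqP->] /eqP->; exists [::];
    first exact: shuffle_nil.
case: z sh_u => [|z0 z] sh_u.
  exists (x :: u); [exact: sh_u|exact: lex_le_refl].
case: (shuffle_consP sh_u) => [[_ [<- <-] {}sh_u]|[b' def_b {}sh_u]].
  have [u' sh_u' le_u] := IHu z a b sh_u le_ba.
  by exists (z0 :: u'); [exact: shuffle_right|rewrite lex_le_cons eqxx le_u
    orbT].
subst b; case: a le_ba sh_u => // y a; rewrite lex_le_cons => + sh_u.
case/orP=> [lt_xy|/andP[/eqP eq_xy le_ba]].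
  (* The letter [y] exceeds [x], so any shuffle that starts with [y] will do. *)
  exists (y :: a ++ z0 :: z ++ x :: b'); first exact/shuffle_left/shuffle_cat.
  by rewrite lex_le_cons lt_xy.
(* Equal heads: the new shuffle takes [x] from [a] instead of [b], and [z] grows by this letter. *)
subst y; rewrite -cat_rcons in sh_u.
have [u' sh_u' le_u] := IHu _ _ _ sh_u le_ba.
exists (x :: u'); last by rewrite lex_le_cons eqxx le_u orbT.
by rewrite cat_rcons in sh_u'; apply: shuffle_left.
Qed.

(** A shuffle that takes the head of [b] first starts with a letter at most the head of [a], since
    [b <= a]. If the heads agree, [shuffle_exchange] gives a shuffle, at least as large, that takes
    this letter from [a]. *)
Lemma shuffle_le_cat u a b :
  (forall i, (i < size a)%N -> lex_le b (drop i a)) ->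
  shuffle u a b -> lex_le u (a ++ b).
Proof.
elim: a u b => [|x a IHa] u b le_b sh_u.
  by rewrite (shuffle_l0 sh_u) lex_le_refl.
have {}IHa v : shuffle v a b -> lex_le v (a ++ b).
  by apply: IHa => i lt_i; apply: (le_b i.+1).
case: u sh_u => // j u /shuffle_consP[[_ [<- <-] {}sh_u]|[b' def_b sh_u]].
  by rewrite /= lex_le_cons eqxx IHa ?orbT.
have := le_b 0%N isT; rewrite def_b /= !lex_le_cons.
case/orP=> [-> //|/andP[/eqP eq_x le_ba]]; subst j.
have [u' sh_u' le_u] := @shuffle_exchange _ [:: x] _ _ sh_u le_ba.
by rewrite eqxx (lex_le_trans le_u) ?orbT // -def_b IHa // def_b.
Qed.

(** Cut before the smallest suffix [b]. To apply [shuffle_le_cat], a nonempty suffix [p] of [a] with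
    [p < b] must be excluded: [b <= p b] makes [p] a prefix of [b], say [b = p x]; then [x <= b],
    while [b <= x] because [x] is a suffix of [w], so [p] would be empty. *)
Lemma non_lyndon_split w : w != [::] -> ~~ lyndon w ->
  exists a b, [/\ w = a ++ b, a != [::], b != [::] &
    forall u, shuffle u a b -> lex_le u w].
Proof.
move=> w0 /negP w_nlyn; have [i lt_i min_i] := min_suffix w0.
have [i0|i_gt0] := posnP i.
  by case: w_nlyn; have := lyndon_min_suffix lt_i min_i; rewrite i0 drop0.
set a := take i w; set b := drop i w;
  have def_w : w = a ++ b by rewrite cat_take_drop.
have size_a : size a = i by rewrite size_takel // ltnW.
exists a, b; split=> //.
- by rewrite -size_eq0 size_a -lt0n.
- by rewrite -size_eq0 size_drop -lt0n subn_gt0.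
move=> u; rewrite def_w; apply: shuffle_le_cat => k lt_k.
have lt_kw : (k < size w)%N by rewrite (ltn_trans lt_k) // size_a.
have le_b : lex_le b (drop k a ++ b) by have := min_i k lt_kw;
  rewrite {2}def_w drop_cat lt_k.
rewrite lex_leNlt; apply/negP => lt_s.
have [/prefixP[x def_b]|Npre] := boolP (prefix (drop k a) b); last first.
  by have := lex_lt_cat b [::] Npre lt_s; rewrite cats0 lex_ltNle le_b.
set j := (i + size (drop k a))%N.
have def_x : x = drop j w by rewrite /j addnC -drop_drop -/b def_b
  drop_size_cat.
have lt_j : (j < size w)%N.
  rewrite -(cat_take_drop i w) size_cat -/a -/b size_a ltn_add2l def_b size_cat.
  rewrite -[X in (X < _)%N]addn0 ltn_add2l lt0n size_eq0.
  by apply: contraTneq lt_s => x0; rewrite def_b x0 cats0 lex_ltxx.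
have le_xb : lex_le x b by move: le_b; rewrite {1}def_b lex_le_catl.
have := min_i j lt_j; rewrite -/b -def_x => le_bx.
have /(congr1 size) := lex_le_anti le_xb le_bx.
rewrite def_b size_cat => /eqP; rewrite -{1}[size x]add0n eqn_add2r eq_sym.
by rewrite size_drop subn_eq0 leqNgt lt_k.
Qed.

End Infiltration.

(** * Group-like series *)

Section Deglex.
Variable n : nat.
Implicit Types u v w : word n.

Definition deglex_lt u v : bool :=
  (size u < size v)%N || (size u == size v) && lex_lt u v.

Lemma deglex_lt_neqAle u v : deglex_lt u v = (u != v) && deglex_le u v.
Proof.
rewrite /deglex_lt /deglex_le lex_lt_neqAle; have [->|] := eqVneq u v.
  by rewrite ltnn andbF.
by [].
Qed.

Lemma deglex_ltxx u : deglex_lt u u = false.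
Proof. by rewrite deglex_lt_neqAle eqxx. Qed.

Lemma deglex_ltNle u v : deglex_lt u v = ~~ deglex_le v u.
Proof.
by rewrite /deglex_lt /deglex_le lex_ltNle negb_or negb_and; case: ltngtP.
Qed.

Lemma deglex_le_trans : transitive (@deglex_le n).
Proof.
move=> v u w; rewrite /deglex_le.
case: (ltngtP (size u) (size v)) => //= uv;
  case: (ltngtP (size v) (size w)) => //= vw.
- by rewrite (ltn_trans uv vw).
- by rewrite -vw uv.
- by rewrite uv vw.
- by rewrite uv vw ltnn eqxx; apply: lex_le_trans.
Qed.

Lemma deglex_lt_size u v : deglex_lt u v -> (size u <= size v)%N.
Proof. by case/orP=> [/ltnW//|/andP[/eqP->]]. Qed.

(** Outer induction on the length; inner induction on the number of lexicographically smaller words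
    of bounded length, which is finite. *)
Lemma deglex_ind (P : word n -> Prop) :
  (forall w, (forall u, deglex_lt u w -> P u) -> P w) -> forall w, P w.
Proof.
move=> indP w; have [m le_m] : exists m, (size w < m)%N by exists (size w).+1.
elim: m => // m IHm in w le_m *.
pose below v := [seq u <- words_upto n m | lex_lt u v].
have [k le_k] : exists k, (size (below w) < k)%N by exists (size (below w)).+1.
elim: k => // k IHk in w le_m le_k *; apply: indP => u /orP[lt_uw|].
  by apply: IHm; apply: leq_trans lt_uw _.
case/andP=> /eqP eq_uw lt_uw; apply: IHk; first by rewrite eq_uw.
rewrite ltnS in le_k; apply: leq_trans le_k;
  apply: (@uniq_leq_size _ (u :: below u) (below w)).
  by rewrite /= mem_filter lex_ltxx filter_uniq // words_upto_uniq.
move=> v; rewrite inE mem_filter => /predU1P[->|].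
  by rewrite mem_filter lt_uw mem_words_upto eq_uw.
by rewrite mem_filter => /andP[lt_v ->]; rewrite (lex_lt_trans lt_v).
Qed.

Lemma deglex_wf : well_founded (fun u v => deglex_lt u v).
Proof. by apply: deglex_ind => w IHw; constructor. Qed.

End Deglex.

Section Grouplike.
Variables (n : nat) (E : comPzRingType).
Implicit Types (f g h : series n E) (a b u w : word n).

Lemma deltaE g a b : delta g a b =
  \sum_(u <- words_upto n (size a + size b)) g u * (infil u a b)%:R.
Proof. by apply: eq_bigr => u _; rewrite infilE. Qed.

Lemma tensorM f g f' g' :
  tensor f g * tensor f' g' = tensor (f * f') (g * g') :> series2 n E.
Proof.
apply/funext => a; apply/funext => b; rewrite mul2E /tensor !mulSE mulr_suml.
by apply: eq_bigr => i _; rewrite mulr_sumr; apply: eq_bigr => k _;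
  rewrite mulrACA.
Qed.

Lemma tensor1 : tensor 1 1 = 1 :> series2 n E.
Proof.
apply/funext => a; apply/funext => b; rewrite /tensor !oneSE.
by case: a => [|x a]; case: b => [|y b]; rewrite /= ?mul1r ?mul0r.
Qed.

Lemma Fr_one : Fr n E 1. Proof. by split=> //; rewrite rmorph1 tensor1. Qed.

Lemma Fr_mul g h : Fr n E g -> Fr n E h -> Fr n E (g * h).
Proof.
move=> [g1 dg] [h1 dh]; split; first by rewrite mulS0E g1 h1 mulr1.
by rewrite rmorphM /= dg dh tensorM.
Qed.

Lemma Fr_inv g : Fr n E g -> Fr n E (inv_series g).
Proof.
move=> [g1 dg]; split; first by rewrite /inv_series big_ord1 expr0.
rewrite -[LHS]mulr1 -tensor1 -(mulSV g1) -tensorM -dg mulrA -rmorphM.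
by rewrite mulVS // rmorph1 mul1r.
Qed.

Lemma Fr_prod I (s : seq I) (F : I -> series n E) :
  (forall i, Fr n E (F i)) -> Fr n E (\prod_(i <- s) F i).
Proof. by move=> FrF; apply: big_ind => //; [exact: Fr_one|exact: Fr_mul]. Qed.

Lemma Fr_one_plus_omega j : Fr n E (val (@one_plus_omega n E j)).
Proof.
split; first exact: one_seriesP.
rewrite /= rmorphD rmorph1 /= delta_omega.
apply/funext => a; apply/funext => b; rewrite !addSE /tensor !addSE.
have -> : (1 : series2 n E) a b = (1 : series n E) a * (1 : series n E) b.
  by rewrite -tensor1.
by rewrite mulrDl !mulrDr !addrA [X in X + _]addrAC.
Qed.

Lemma Fr_Xi L : Fr n E (val (Xi (@one_plus_omega n E) L)).
Proof.
have [m le_m] : exists m, (size L < m)%N by exists (size L).+1.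
elim: m => // m IHm in L le_m *; case: (ltnP 1 (size L)) => [L_gt1|];
  last first.
  case: L le_m => [|j [|//]] _ _; first exact: Fr_one.
  by rewrite Xi_letter; apply: Fr_one_plus_omega.
have [/andP[c_gt0 lt_c] _ _] := lyndon_cutP L_gt1.
rewrite Xi_split // /commg /conjg.
have Fr_t : Fr n E (val (Xi (@one_plus_omega n E) (take (lyndon_cut L) L))).
  by apply: IHm; rewrite size_takel; lia.
have Fr_d : Fr n E (val (Xi (@one_plus_omega n E) (drop (lyndon_cut L) L))).
  by apply: IHm; rewrite size_drop; lia.
by rewrite !val_mulO; do !apply: Fr_mul => //; apply: Fr_inv.
Qed.

End Grouplike.

(** * Coefficients of group-like series at Lyndon words *)

Section LyndonDetermines.
Variables (n : nat) (E : comPzRingType) (ratE : {rmorphism rat -> E}).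
Implicit Types (g h : series n E) (a b u w : word n).

Lemma ratE_natV k : (0 < k)%N -> ratE (k%:R^-1) * k%:R = 1.
Proof.
move=> k_gt0; rewrite -(rmorph_nat ratE) -rmorphM mulVf ?rmorph1 //.
by rewrite Num.Theory.pnatr_eq0 -lt0n.
Qed.

(** [E] may have zero divisors, but positive integers are invertible in it. *)
Lemma natr_mul_eq0 k (x : E) : (0 < k)%N -> x * k%:R = 0 -> x = 0.
Proof.
by move=> k_gt0 xk0; rewrite -[x]mul1r -(ratE_natV k_gt0) -mulrA [_ * x]mulrC
  xk0 mulr0.
Qed.

(* For [w] non-Lyndon, split as [a b], the group-like condition at [(a, b)]
   expresses a positive multiple of the coefficient at [w] through coefficients
   at [deglex]-smaller words. *)
Lemma Fr_eq_lyndon m g h : Fr n E g -> Fr n E h ->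
  (forall L, lyndon L -> (size L <= m)%N -> g L = h L) ->
  forall w, (size w <= m)%N -> g w = h w.
Proof.
move=> [g1 dg] [h1 dh] eq_lyn; elim/deglex_ind => w IHw le_w.
have [->|w0] := eqVneq w [::]; first by rewrite g1 h1.
have [/eq_lyn->//|w_nlyn] := boolP (lyndon w).
have [a [b [def_w a0 b0 sh_le]]] := non_lyndon_split w0 w_nlyn.
have size_w : size w = (size a + size b)%N by rewrite def_w size_cat.
have a_gt0 : (0 < size a)%N by rewrite lt0n size_eq0.
have b_gt0 : (0 < size b)%N by rewrite lt0n size_eq0.
have {}IHw u : deglex_lt u w -> g u = h u.
  by move=> lt_u; apply/(IHw _ lt_u)/(leq_trans (deglex_lt_size lt_u)).
have eq_d : delta g a b = delta h a b.
  by rewrite dg dh /tensor (IHw a) ?(IHw b) // /deglex_lt size_w; lia.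
(* A word [u] of the sum that is neither [w] nor smaller has the length of [w]; with positive
   multiplicity it would be a shuffle of [a] and [b], hence at most [w]. *)
have eq_rest :
    \sum_(u <- words_upto n (size w) | u != w) g u * (infil u a b)%:R =
    \sum_(u <- words_upto n (size w) | u != w) h u * (infil u a b)%:R.
  rewrite big_seq_cond [RHS]big_seq_cond; apply: eq_bigr => u.
  rewrite mem_words_upto => /andP[le_u neq_u].
  have [/IHw->//|Nlt_u] := boolP (deglex_lt u w).
  have [->|/infil_shuffle sh_u] := posnP (infil u a b); first by rewrite !mulr0.
  case/negP: Nlt_u; rewrite deglex_lt_neqAle neq_u /deglex_le.
  by case: ltngtP le_u => //= eq_u _; apply/sh_le/sh_u; rewrite -size_w.
move: eq_d; rewrite !deltaE -size_w.
rewrite (bigD1_seq w) ?words_upto_uniq ?mem_words_upto //=.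
rewrite [in RHS](bigD1_seq w) ?words_upto_uniq ?mem_words_upto //= eq_rest.
move=> /addIr eq_w; apply/subr0_eq/(@natr_mul_eq0 (infil w a b)).
  by rewrite def_w; apply/shuffle_infil/shuffle_cat.
by rewrite mulrBl eq_w subrr.
Qed.

End LyndonDetermines.

(** * Powers of group-like series *)

Section Powers.
Variables (n : nat) (E : comPzRingType) (ratE : {rmorphism rat -> E}).
Implicit Types (t c : E) (f h : E -> E) (x g : series n E) (w : word n).

Local Notation binom := (binom_coef ratE).

Lemma binom_coef0 t : binom t 0 = 1.
Proof. by rewrite /binom_coef big_ord0 fact0 invr1 rmorph1 mulr1. Qed.

Lemma binom_coefS t m :
  binom t m.+1 = ratE (m.+1%:R^-1) * (t - m%:R) * binom t m.
Proof.
rewrite /binom_coef big_ord_recr /= factS natrM invfM rmorphM /=.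
rewrite -!mulrA; congr (_ * _). by rewrite mulrA mulrC.
Qed.

(** Multiplication by [t] in the binomial basis, used to show that polynomial functions are closed
    under products. *)
Lemma mul_binom_coef t m :
  t * binom t m = m.+1%:R * binom t m.+1 + m%:R * binom t m.
Proof.
rewrite binom_coefS; move: (binom t m) => B.
by rewrite !mulrA [m.+1%:R * _]mulrC ratE_natV // mul1r -mulrDl subrK.
Qed.

Lemma binom_coef1 t : binom t 1 = t.
Proof. by rewrite binom_coefS binom_coef0 invr1 rmorph1 mul1r subr0 mulr1. Qed.

(** As [t] is an arbitrary ring element, the proof is an induction on [m]; both sides of the step
    equal [(t + 1) / (m + 2)] times [binom t m.+1]. *)
Lemma binom_coef_pascal t m :
  binom (t + 1) m.+1 = binom t m.+1 + binom t m.
Proof.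
elim: m => [|m IHm]; first by rewrite !binom_coef1 binom_coef0.
rewrite binom_coefS IHm mulrDr [binom t m.+2]binom_coefS.
have -> : t + 1 - m.+1%:R = t - m%:R by rewrite -natr1 opprD addrACA subrr
  addr0.
have -> : ratE (m.+2%:R^-1) * (t - m%:R) * binom t m =
    ratE (m.+2%:R^-1) * m.+1%:R * binom t m.+1.
  rewrite binom_coefS; move: (binom t m) => B; rewrite -!mulrA; congr (_ * _).
  by rewrite [RHS]mulrA [m.+1%:R * _]mulrC ratE_natV // mul1r.
rewrite -mulrDl -mulrDr.
have -> : t - m%:R + m.+1%:R = t - m.+1%:R + m.+2%:R.
  have addK k : t - k%:R + k.+1%:R = t + 1 by rewrite -natr1 addrA subrK.
  by rewrite !addK.
by rewrite mulrDr ratE_natV // mulrDl mul1r.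
Qed.

Lemma binom_coef_nat k m : binom k%:R m = 'C(k, m)%:R.
Proof.
elim: k m => [|k IHk] [|m]; rewrite ?binom_coef0 ?bin0 //.
  by rewrite bin0n /= /binom_coef big_ord_recl subrr mul0r mulr0.
by rewrite -natr1 binom_coef_pascal !IHk binS natrD.
Qed.

(** For negative arguments, Pascal's rule is solved for its term of order [m.+1] at the smaller
    argument; inductions on [m] and [k] then reach all of them. *)
Lemma binom_coef_int (z : int) m : integers E (binom z%:~R m).
Proof.
have natP (k : nat) : integers E k%:R by exists k%:Z.
have add_int a b : integers E a -> integers E b -> integers E (a + b).
  by move=> [i _ <-] [j _ <-]; exists (i + j) => //; rewrite rmorphD.
have opp_int a : integers E a -> integers E (- a).
  by move=> [i _ <-]; exists (- i) => //; rewrite rmorphN.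
case: z => [k|k]; first by rewrite -[_%:~R]/(k%:R) binom_coef_nat.
rewrite NegzE rmorphN /= -[_%:~R]/(k.+1%:R).
elim: m k => [|m IHm] k; first by rewrite binom_coef0; apply: (natP 1%N).
elim: k => [|k IHk].
  have := binom_coef_pascal (- 1) m; rewrite addrC subrr.
  move=> /eqP; rewrite -subr_eq => /eqP <-; apply: add_int;
    last exact: (opp_int _ (IHm 0%N)).
  by rewrite (binom_coef_nat 0).
have := binom_coef_pascal (- k.+2%:R) m.
have -> : - k.+2%:R + 1 = - k.+1%:R :> E by rewrite -natr1 opprD subrK.
by move=> /eqP; rewrite -subr_eq => /eqP <-; apply: add_int;
  last exact/opp_int/(IHm k.+1).
Qed.

(* Polynomial functions.  In this basis the coefficients are determined by the
   values at natural numbers without assuming [E] to be a domain. *)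
Definition binom_poly f : Prop :=
  exists N (c : nat -> E), forall t, f t = \sum_(m < N) c m * binom t m.

Lemma binom_poly1 c k : binom_poly (fun t => c * binom t k).
Proof.
exists k.+1, (fun i => if i == k then c else 0) => t.
rewrite big_ord_recr /= eqxx big1 ?add0r // => i _.
by rewrite ltn_eqF ?mul0r.
Qed.

Lemma binom_polyD f h : binom_poly f -> binom_poly h ->
  binom_poly (fun t => f t + h t).
Proof.
move=> [N [c fE]] [M [d hE]].
(* Padding with zeros brings both expansions to the same length. *)
pose e K (c : nat -> E) i := if (i < K)%N then c i else 0.
have eE K (c' : nat -> E) t : (K <= N + M)%N ->
    \sum_(m < K) c' m * binom t m = \sum_(m < N + M) e K c' m * binom t m.
  move=> le_K; rewrite (big_ord_widen _ (fun m => c' m * binom t m) le_K).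
  by rewrite big_mkcond; apply: eq_bigr => i _; rewrite /e; case: ifP;
    rewrite ?mul0r.
exists (N + M)%N, (fun i => e N c i + e M d i) => t.
rewrite fE hE (eE N) ?(eE M) ?leq_addr ?leq_addl // -big_split.
by apply: eq_bigr => i _; rewrite mulrDl.
Qed.

Lemma binom_poly_sum I (s : seq I) (F : I -> E -> E) :
  (forall i, binom_poly (F i)) -> binom_poly (fun t => \sum_(i <- s) F i t).
Proof.
move=> polyF; elim: s => [|i s [N [c IHs]]].
  by exists 0%N, (fun=> 0) => t; rewrite big_nil big_ord0.
have [N' [c' E']] := binom_polyD (polyF i) (ex_intro _ N (ex_intro _ c IHs)).
by exists N', c' => t; rewrite big_cons E'.
Qed.

Lemma binom_poly_ext f h : f =1 h -> binom_poly f -> binom_poly h.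
Proof. by move=> eq_fh [N [c fE]]; exists N, c => t; rewrite -eq_fh. Qed.

(** The multiplier has the shape of the factor in [binom_coefS], so repeated use multiplies by
    [binom t m]. *)
Lemma binom_poly_linear c k f : binom_poly f ->
  binom_poly (fun t => c * (t - k%:R) * f t).
Proof.
move=> [N [d fE]].
have polyF (m : 'I_N) : binom_poly (fun t => c * d m * m.+1%:R * binom t m.+1 +
    c * d m * (m%:R - k%:R) * binom t m).
  by apply: binom_polyD; apply: binom_poly1.
apply: binom_poly_ext (binom_poly_sum (index_enum 'I_N) polyF) => t.
rewrite fE mulr_sumr; apply: eq_bigr => m _.
rewrite -!mulrA -!mulrDr; congr (c * _).
by rewrite [RHS]mulrCA; congr (d m * _); rewrite !mulrBl addrA -mul_binom_coef.
Qed.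

Lemma binom_poly_mul f h : binom_poly f -> binom_poly h ->
  binom_poly (fun t => f t * h t).
Proof.
move=> [N [c fE]] polyh.
have polyF m : binom_poly (fun t => binom t m * h t).
  elim: m => [|m IHm]; first by apply: binom_poly_ext polyh => t;
    rewrite binom_coef0 mul1r.
  apply: binom_poly_ext (binom_poly_linear (ratE (m.+1%:R^-1)) m IHm) => t.
  by rewrite binom_coefS mulrA.
have polyC c' f' : binom_poly f' -> binom_poly (fun t => c' * f' t).
  move=> [M [d f'E]]; exists M, (fun m => c' * d m) => t.
  by rewrite f'E mulr_sumr; apply: eq_bigr => m _; rewrite mulrA.
have polyG (m : 'I_N) : binom_poly (fun t => c m * (binom t m * h t)) by
  apply/polyC/polyF.
apply: binom_poly_ext (binom_poly_sum (index_enum 'I_N) polyG) => t.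
by rewrite fE mulr_suml; apply: eq_bigr => m _; rewrite mulrA.
Qed.

(** The coefficients of the difference vanish one after the other: at [t = m] the terms beyond [m]
    are zero, those before [m] are already known to vanish, and [binom m m] is 1. *)
Lemma binom_poly_eq f h : binom_poly f -> binom_poly h ->
  (forall k, f k%:R = h k%:R) -> f =1 h.
Proof.
move=> polyf polyh eq_nat.
have [N [c fhE]] : binom_poly (fun t => f t - h t).
  have := binom_polyD polyf (binom_poly_mul (binom_poly1 (-1) 0) polyh).
  by apply: binom_poly_ext => t; rewrite binom_coef0 mulr1 mulN1r.
suff c0 m : (m < N)%N -> c m = 0.
  by move=> t; apply/subr0_eq; rewrite fhE big1 // => m _; rewrite c0 ?mul0r.
have [b le_b] : exists b, (m < b)%N by exists m.+1.
elim: b => // b IHb in m le_b * => lt_m.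
have := fhE m%:R; rewrite eq_nat subrr (bigD1 (Ordinal lt_m)) //= binom_coef_nat
  binn mulr1.
rewrite big1 ?addr0 // => i /eqP ne_i; rewrite binom_coef_nat.
case: (ltngtP i m) => [lt_im|lt_mi|eq_im]; last by case: ne_i; apply: val_inj.
  by rewrite IHb ?mul0r //; apply: leq_trans lt_im _.
by rewrite bin_small ?mulr0.
Qed.

Lemma pow_seriesE x t w N : x [::] = 0 -> (size w <= N)%N ->
  pow_series ratE x t w = \sum_(m < N.+1) binom t m * (x ^+ m) w.
Proof.
move=> x0 le_wN; rewrite /pow_series.
rewrite (big_ord_widen N.+1 (fun m => binom t m * (x ^+ m) w)) ?ltnS //.
rewrite big_mkcond; apply: eq_bigr => i _; case: ltnP => // lt_wi.
by rewrite expS_small ?mulr0.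
Qed.

Lemma pow_series_nat x k : x [::] = 0 -> pow_series ratE x k%:R = (1 + x) ^+ k.
Proof.
move=> x0; apply/funext => w;
  rewrite (@pow_seriesE _ _ _ (size w + k)) ?leq_addr //.
have mulrnSE (f : series n E) i : (f *+ i) w = f w * i%:R.
  by elim: i => [|i IHi]; rewrite ?mulr0 // mulrSr addSE IHi -natr1 mulrDr
    mulr1.
rewrite addrC exprD1n sumSE.
rewrite [RHS](big_ord_widen (size w + k).+1 (fun m => (x ^+ m *+ 'C(k, m)) w));
  last first.
  by rewrite ltnS leq_addl.
rewrite [RHS]big_mkcond; apply: eq_bigr => i _.
rewrite mulrnSE binom_coef_nat mulrC; case: ltnP => // lt_ki.
by rewrite bin_small ?mulr0.
Qed.

Lemma binom_poly_pow x w : binom_poly (fun t => pow_series ratE x t w).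
Proof.
apply: binom_poly_ext (binom_poly_sum (index_enum 'I_(size w).+1)
  (fun m : 'I_(size w).+1 => binom_poly1 ((x ^+ m) w) m)) => t.
by apply: eq_bigr => m _; rewrite mulrC.
Qed.

(* Both sides of the group-like condition for [g ^ t] are polynomials in [t],
   and the condition holds when [t] is a natural number. *)
Lemma Fr_pow g t : Fr n E g -> Fr n E (pow_series ratE (g - 1) t).
Proof.
move=> Fr_g; have x0 : (g - 1) [::] = 0 by rewrite addSE Fr_g.1 subrr.
split; first by rewrite /pow_series big_ord1 binom_coef0 mul1r expr0.
apply/funext => a; apply/funext => b; rewrite deltaE /tensor.
set s := words_upto _ _; set P := pow_series ratE (g - 1).
pose lhs t := \sum_(u <- s) P t u * (infil u a b)%:R.
suff : lhs =1 (fun t => P t a * P t b) by apply.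
apply: binom_poly_eq.
- apply: binom_poly_sum => u.
  have := binom_poly_mul (binom_poly_pow (g - 1) u) (binom_poly1 (infil u a
    b)%:R 0).
  by apply: binom_poly_ext => k; rewrite binom_coef0 mulr1.
- by apply: binom_poly_mul; apply: binom_poly_pow.
move=> k; rewrite /lhs /P pow_series_nat // [1 + _]addrC subrK -deltaE.
suff [_ ->] : Fr n E (g ^+ k) by [].
by elim: k => [|k IHk]; [exact: Fr_one|rewrite exprS; apply: Fr_mul].
Qed.

End Powers.

(** * Leading terms of the factors *)

Section LeadingTerms.
Variables (n : nat) (E : comPzRingType).
Implicit Types (f g x : series n E) (k l : nat) (u v w : word n).

Definition vanish_below k f := forall w, (size w < k)%N -> f w = 0.

Lemma vanish_mul k l f g :
  vanish_below k f -> vanish_below l g -> vanish_below (k + l) (f * g).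
Proof.
move=> f0 g0 w lt_w; rewrite mulSE big1 // => i _.
have [lt_k|le_k] := ltnP (size (take i w)) k; first by rewrite f0 ?mul0r.
rewrite [g _]g0 ?mulr0 // size_drop; have := ltn_ord i.
by move: le_k; rewrite size_take_min; lia.
Qed.

Lemma mul_leading k l f g w : vanish_below k f -> vanish_below l g ->
  size w = (k + l)%N -> (f * g) w = f (take k w) * g (drop k w).
Proof.
move=> f0 g0 size_w; have lt_k : (k < (size w).+1)%N by rewrite size_w ltnS
  leq_addr.
rewrite mulSE (bigD1 (Ordinal lt_k)) //= big1 ?addr0 // => i /eqP ne_i.
have lt_i := ltn_ord i; case: (ltngtP i k) => [lt_ik|lt_ki|eq_ik].
- by rewrite f0 ?mul0r // size_take_min; lia.
- by rewrite [g _]g0 ?mulr0 // size_drop; lia.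
- by case: ne_i; apply: val_inj.
Qed.

(** Only the empty prefix of [w] leaves a suffix long enough for [g]. *)
Lemma mul_unipotent k f g w : f [::] = 1 -> vanish_below k g ->
  (size w <= k)%N -> (f * g) w = g w.
Proof.
move=> f1 g0 le_w; rewrite mulSE big_ord_recl /= take0 drop0 f1 mul1r.
rewrite big1 ?addr0 // => i _; rewrite [g _]g0 ?mulr0 // size_drop /bump /=.
by have := ltn_ord i; lia.
Qed.

(** [u] is the lexicographically smallest word in the lowest degree of [f]; larger words of that
    degree and longer words are unrestricted. *)
Definition leading_word f u :=
  [/\ vanish_below (size u) f,
      forall w, size w = size u -> lex_lt w u -> f w = 0 & f u = 1].

(** A word of the same length below [u v] has its prefix below [u] or its suffix below [v], and one
    factor vanishes there. *)
Lemma leading_word_mul f g u v :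
  leading_word f u -> leading_word g v -> leading_word (f * g) (u ++ v).
Proof.
move=> [f0 f_lt f1] [g0 g_lt g1]; split.
- by rewrite size_cat; apply: vanish_mul.
- move=> w; rewrite size_cat => size_w lt_w; rewrite (mul_leading f0 g0) //.
  have size_t : size (take (size u) w) = size u by rewrite size_takel // size_w
    leq_addr.
  have size_d : size (drop (size u) w) = size v by rewrite size_drop size_w
    addKn.
  have [le_u|] := boolP (lex_le u (take (size u) w)); last first.
    by rewrite -lex_ltNle => /f_lt-> //; rewrite mul0r.
  have [le_v|] := boolP (lex_le v (drop (size u) w)); last first.
    by rewrite -lex_ltNle => /g_lt-> //; rewrite mulr0.
  by move: lt_w; rewrite -(cat_take_drop (size u) w) lex_ltNle lex_le_cat.
- by rewrite (mul_leading f0 g0) ?size_cat // take_size_cat // drop_size_cat //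
    f1 g1 mulr1.
Qed.

Lemma leading_word_sub f g u v : size u = size v -> lex_lt u v ->
  leading_word f u -> leading_word g v -> leading_word (f - g) u.
Proof.
move=> eq_uv lt_uv [f0 f_lt f1] [g0 g_lt g1]; split.
- by move=> w lt_w; rewrite addSE oppSE f0 // g0 ?subrr -?eq_uv.
- move=> w size_w lt_w; rewrite addSE oppSE f_lt // g_lt ?subrr -?eq_uv //.
  exact: lex_lt_trans lt_uv.
- by rewrite addSE oppSE f1 g_lt ?subr0.
Qed.

Lemma leading_word_mull f g u :
  f [::] = 1 -> leading_word g u -> leading_word (f * g) u.
Proof.
move=> f1 [g0 g_lt g1]; split.
- by move=> w lt_w; rewrite (mul_unipotent f1 g0) ?g0 // ltnW.
- by move=> w size_w lt_w; rewrite (mul_unipotent f1 g0) ?g_lt // size_w.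
- by rewrite (mul_unipotent f1 g0).
Qed.

(** Up to unipotent factors on the left, this is the ring commutator of [a] and [b], which does not
    change when 1 is subtracted from both. *)
Lemma commg_sub1 (a b : one_series n E) :
  val [~ a, b]%g - 1 = val a^-1%g *
    (val b^-1%g * ((val a - 1) * (val b - 1) - (val b - 1) * (val a - 1))).
Proof.
have -> : (val a - 1) * (val b - 1) - (val b - 1) * (val a - 1) =
    val a * val b - val b * val a.
  set x := val a - 1; set y := val b - 1.
  have -> : val a = x + 1 by rewrite subrK.
  have -> : val b = y + 1 by rewrite subrK.
  have mul1D (f g : series n E) : (f + 1) * (g + 1) = f * g + (f + g + 1).
    by rewrite mulrDl !mulrDr !mulr1 !mul1r -!addrA.
  by rewrite !mul1D [y + x]addrC opprD addrACA subrr addr0.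
rewrite /commg /conjg !val_mulO mulrBr mulrBr !mulrA; congr (_ - _).
have mulV (c : one_series n E) : val c^-1%g * val c = 1 := mulVS (one_seriesP
  c).
by rewrite -[_ * _ * val b]mulrA mulV mulr1 mulV.
Qed.

(** For the standard factorization [L = u v], the products in the two orders lead with [u v] and
    [v u], and [u v < v <= v u] as [L] is Lyndon; hence the difference in [commg_sub1] leads with
    [L]. *)
Lemma Xi_leading L : lyndon L ->
  leading_word (val (Xi (@one_plus_omega n E) L) - 1) L.
Proof.
have [m le_m] : exists m, (size L < m)%N by exists (size L).+1.
elim: m => // m IHm in L le_m * => L_lyn; case: (ltnP 1 (size L)) => [L_gt1|];
  last first.
  case: L L_lyn le_m => [|j [|//]] // _ _ _; rewrite Xi_letter /= addrC addKr.
  split; rewrite /omega ?eqxx //; first by case.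
  case=> [|x []] //= _; rewrite lex_lt_cons eqseq_cons andbT andbF orbF.
  by case: eqP => // ->; rewrite ltnn.
have [/andP[c_gt0 lt_c] d_lyn _] := lyndon_cutP L_gt1.
have t_lyn := lyndon_take_cut L_lyn L_gt1.
rewrite Xi_split //; set c := lyndon_cut L in c_gt0 lt_c d_lyn t_lyn *.
set u := take c L in t_lyn *; set v := drop c L in d_lyn *.
have def_L : L = u ++ v by rewrite cat_take_drop.
have size_u : size u = c by rewrite size_takel // ltnW.
have size_v : size v = (size L - c)%N by rewrite size_drop.
have lead_u : leading_word (val (Xi (@one_plus_omega n E) u) - 1) u.
  by apply: IHm => //; lia.
have lead_v : leading_word (val (Xi (@one_plus_omega n E) v) - 1) v.
  by apply: IHm => //; lia.
rewrite commg_sub1; do 2!(apply: leading_word_mull; first exact: one_seriesP).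
rewrite [X in leading_word _ X]def_L; apply: (@leading_word_sub _ _ _ (v ++ u)).
- by rewrite !size_cat addnC.
- apply: lex_lt_le_trans (lex_le_prefix v u); rewrite -def_L.
  by apply: lyndon_lt_drop; rewrite // c_gt0.
- exact: leading_word_mul.
- exact: leading_word_mul.
Qed.

End LeadingTerms.

(** * Ordered products over Lyndon words *)

Section LyndonProducts.
Variables (n : nat) (E : comPzRingType) (ratE : {rmorphism rat -> E}).
Implicit Types (f g x : series n E) (k l : nat) (u v w : word n).
Implicit Types (L K : lyndon_word n) (t : lyndon_word n -> E).

(** The powers [x ^+ m] with [m >= 2] start in degree at least [2 k], beyond [k]. *)
Lemma pow_series_low k x c w : (0 < k)%N -> vanish_below k x ->
  (size w <= k)%N -> pow_series ratE x c w = (w == [::])%:R + c * x w.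
Proof.
move=> k_gt0 x0 le_w; rewrite (@pow_seriesE _ _ _ _ _ _ (size w).+1) //;
  last exact: x0.
rewrite !big_ord_recl /= binom_coef0 expr0 mul1r oneSE binom_coef1 expr1.
rewrite big1 ?addr0 // => i _; rewrite /bump /= !add1n.
have vX m : vanish_below 0 (x ^+ m) by [].
have := vanish_mul x0 (vanish_mul x0 (vX i)); rewrite -!exprS => -> //.
  by rewrite mulr0.
by lia.
Qed.

Definition lyndon_factor L (c : E) : series n E :=
  pow_series ratE (val (Xi one_plus_omega (val L)) - 1) c.

Lemma lyndon_factor_low L c w : (size w <= size (val L))%N ->
  lyndon_factor L c w =
    (w == [::])%:R + c * (val (Xi (@one_plus_omega n E) (val L)) - 1) w.
Proof.
have [v0 _ _] := Xi_leading E (valP L).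
by apply: (pow_series_low _ _ v0); apply: lyndon_size (valP L).
Qed.

Lemma lyndon_factor_below L c w : (size w < size (val L))%N ->
  lyndon_factor L c w = (1 : series n E) w.
Proof.
move=> lt_w; rewrite lyndon_factor_low ?oneSE; last exact: ltnW.
by have [L0 _ _] := Xi_leading E (valP L); rewrite (L0 w lt_w) mulr0 addr0.
Qed.

Lemma lyndon_factor_self L c : lyndon_factor L c (val L) = c.
Proof.
have [_ _ L1] := Xi_leading E (valP L); rewrite lyndon_factor_low // L1 mulr1.
by case/andP: (valP L) => /negbTE->; rewrite add0r.
Qed.

Lemma lyndon_factor_gt K L c : deglex_lt (val L) (val K) ->
  lyndon_factor K c (val L) = 0.
Proof.
move=> lt_LK; have [K0 K_lt _] := Xi_leading E (valP K).
rewrite lyndon_factor_low ?deglex_lt_size //.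
have -> : (val (Xi (@one_plus_omega n E) (val K)) - 1) (val L) = 0.
  by case/orP: lt_LK => [/K0|/andP[/eqP eq_LK /K_lt->]].
by rewrite mulr0 addr0; case/andP: (valP L) => /negbTE->.
Qed.

Lemma lyndon_factor0 L c : lyndon_factor L c [::] = 1.
Proof. by rewrite lyndon_factor_below // lyndon_size ?(valP L). Qed.

Lemma lyndon_prod0 t (s : seq (lyndon_word n)) :
  (\prod_(K <- s) lyndon_factor K (t K)) [::] = 1.
Proof.
elim: s => [|K s IHs]; first by rewrite big_nil.
by rewrite big_cons mulS0E IHs lyndon_factor0 mulr1.
Qed.

(** Each factor is 1 plus terms of degree at least [size w], so multiplying by it only adds its own
    coefficient at [w]. *)
Lemma prod_low_coef (f : series n E) t s w : f [::] = 1 -> w != [::] ->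
  (forall K, K \in s -> (size w <= size (val K))%N) ->
  (f * \prod_(K <- s) lyndon_factor K (t K)) w =
    f w + \sum_(K <- s) lyndon_factor K (t K) w.
Proof.
move=> + w0; elim: s f => [|K s IHs] f f1 le_s.
  by rewrite !big_nil mulr1 addr0.
rewrite !big_cons mulrA IHs; last 2 first.
- by rewrite mulS0E f1 lyndon_factor0 mulr1.
- by move=> K' K's; apply: le_s; rewrite inE K's orbT.
rewrite addrA; congr (_ + _).
have -> : lyndon_factor K (t K) = 1 + (lyndon_factor K (t K) - 1) by rewrite
  addrC subrK.
have le_K : (size w <= size (val K))%N by apply: le_s; rewrite inE eqxx.
rewrite mulrDr mulr1 addSE (@mul_unipotent _ _ (size (val K))) //.
  by rewrite [in RHS]addSE oneSE (negbTE w0) add0r.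
by move=> u lt_u; rewrite addSE oppSE lyndon_factor_below // subrr.
Qed.

Definition lyndon_prod_below t w : series n E :=
  \prod_(K <- lyndon_upto n (size w) | deglex_lt (val K) w) lyndon_factor K (t
    K).

(** The ordered list splits at [L]. From there on the words are at least as long as [L], so their
    coefficients at [L] simply add: [L] contributes [t L], the larger words 0. The earlier factors
    form [lyndon_prod_below]. *)
Lemma lyndon_prod_coef t L :
  (\prod_(K <- lyndon_upto n (size (val L))) lyndon_factor K (t K)) (val L) =
    t L + lyndon_prod_below t (val L) (val L).
Proof.
rewrite /lyndon_prod_below.
have := lyndon_upto_sorted n (size (val L));
  have := lyndon_upto_uniq n (size (val L)).
have : L \in lyndon_upto n (size (val L)) by rewrite mem_lyndon_upto.
case/splitPr => s1 s2; rewrite cat_uniq /= => /and4P[_].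
rewrite negb_or => /andP[L_s1 _] L_s2 _.
rewrite sorted_pairwise; last by move=> K M N; apply: deglex_le_trans.
rewrite pairwise_cat /= => /and4P[+ _ + _].
rewrite allrel_consr => /andP[/allP le_s1 _] /allP le_s2.
have lt_s1 K : K \in s1 -> deglex_lt (val K) (val L).
  move=> Ks1; rewrite deglex_lt_neqAle le_s1 // andbT (inj_eq val_inj).
  by apply: contraNneq L_s1 => <-.
have lt_s2 K : K \in s2 -> deglex_lt (val L) (val K).
  move=> Ks2; rewrite deglex_lt_neqAle le_s2 // andbT (inj_eq val_inj).
  by apply: contraNneq L_s2 => ->.
rewrite !big_cat /= prod_low_coef; first last.
- by move=> K; rewrite inE => /predU1P[->//|/lt_s2/deglex_lt_size].
- by case/andP: (valP L).
- exact: lyndon_prod0.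
rewrite !big_cons deglex_ltxx lyndon_factor_self addrCA.
have -> : \sum_(K <- s2) lyndon_factor K (t K) (val L) = 0.
  by rewrite big_seq big1 // => K Ks2; rewrite lyndon_factor_gt // lt_s2.
rewrite addr0; congr (_ + _).
have -> : \prod_(K <- s1 | deglex_lt (val K) (val L)) lyndon_factor K (t K) =
    \prod_(K <- s1) lyndon_factor K (t K).
  rewrite big_seq_cond [RHS]big_seq; apply: eq_bigl => K.
  by case: (boolP (K \in s1)) => // /lt_s1->.
rewrite [X in _ * X]big_seq_cond [X in _ * X]big1 ?mulr1 //.
move=> K /andP[/lt_s2 + lt_K].
by rewrite deglex_ltNle; move: lt_K; rewrite deglex_lt_neqAle => /andP[_ ->].
Qed.

(** Factors of words longer than [w] agree with 1 up to the degree of [w], and removing them keeps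
    the order of the others. *)
Lemma lyndon_prod_stable t m w : (size w <= m)%N ->
  (\prod_(K <- lyndon_upto n m) lyndon_factor K (t K)) w =
  (\prod_(K <- lyndon_upto n (size w)) lyndon_factor K (t K)) w.
Proof.
move=> le_w; set k := size w.
have -> : lyndon_upto n k = [seq K <- lyndon_upto n m | (size (val K) <= k)%N].
  apply: (@sorted_eq _ (fun L M : lyndon_word n => deglex_le (val L) (val M))).
  - by move=> K M N; apply: deglex_le_trans.
  - move=> K M /andP[le_KM le_MK]; apply/val_inj/eqP; move: le_MK;
      apply: contraTT => neq_KM.
    by rewrite -deglex_ltNle deglex_lt_neqAle neq_KM.
  - exact: lyndon_upto_sorted.
  - apply: sorted_filter; last exact: lyndon_upto_sorted.
    by move=> K M N; apply: deglex_le_trans.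
  apply: uniq_perm; rewrite ?filter_uniq ?lyndon_upto_uniq // => K.
  rewrite mem_filter !mem_lyndon_upto andb_idr // => le_K.
  exact: leq_trans le_w.
(* [k] is detached from [w], since the induction passes to suffixes of [w]. *)
rewrite big_filter; have := leqnn (size w); rewrite -[X in (_ <= X)%N]/k.
clearbody k; elim: (lyndon_upto n m) {le_w} w => [|K s IHs] w le_w.
  by rewrite !big_nil.
have size_t i : (size (take i w) <= k)%N by rewrite size_take_min; lia.
have size_d i : (size (drop i w) <= k)%N by rewrite size_drop; lia.
rewrite !big_cons; case: leqP => [le_K|lt_K].
  by rewrite !mulSE; apply: eq_bigr => i _; rewrite IHs.
rewrite -[X in _ = X _]mul1r !mulSE; apply: eq_bigr => i _.
by rewrite IHs // lyndon_factor_below // (leq_ltn_trans (size_t i)).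
Qed.

End LyndonProducts.

(** * Coefficients, exponents and convergence *)

Section Coefficients.
Variables (n : nat) (E : comPzRingType) (ratE : {rmorphism rat -> E}).
Implicit Types (f g : series n E) (w : word n).
Implicit Types (L K : lyndon_word n) (t : lyndon_word n -> E).

Definition set_subring (S : set E) : Prop :=
  [/\ S 1, forall x y, S x -> S y -> S (x - y) &
    forall x y, S x -> S y -> S (x * y)].

Section Subring.
Variable S : set E.
Hypothesis S_ring : set_subring S.

Let S1 : S 1. Proof. by case: S_ring. Qed.
Let SB x y : S x -> S y -> S (x - y). Proof. by case: S_ring => _ + _; apply.
Qed.
Let SM x y : S x -> S y -> S (x * y). Proof. by case: S_ring => _ _; apply. Qed.
Let S0 : S 0. Proof. by rewrite -(subrr 1); apply: SB. Qed.
Let SD x y : S x -> S y -> S (x + y).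
Proof. by move=> Sx Sy; rewrite -[y]opprK; apply: SB => //; rewrite -sub0r;
  apply: SB. Qed.
Let S_sum I (r : seq I) (P : pred I) (F : I -> E) :
  (forall i, S (F i)) -> S (\sum_(i <- r | P i) F i).
Proof. by move=> SF; apply: big_ind. Qed.

Definition coefs_in f : Prop := forall w, S (f w).

Lemma coefs_in1 : coefs_in 1. Proof. by move=> w; rewrite oneSE; case: eqP. Qed.

Lemma coefs_inM f g : coefs_in f -> coefs_in g -> coefs_in (f * g).
Proof. by move=> Sf Sg w; rewrite mulSE; apply: S_sum => i; apply: SM. Qed.

Lemma coefs_inB f g : coefs_in f -> coefs_in g -> coefs_in (f - g).
Proof. by move=> Sf Sg w; apply: SB. Qed.

Lemma coefs_inX f m : coefs_in f -> coefs_in (f ^+ m).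
Proof.
move=> Sf; elim: m => [|m IHm]; first exact: coefs_in1.
by rewrite exprS; apply: coefs_inM.
Qed.

Lemma coefs_in_inv f : coefs_in f -> coefs_in (inv_series f).
Proof.
by move=> Sf w; apply: S_sum => m; apply/coefs_inX/coefs_inB => //;
  apply: coefs_in1.
Qed.

Lemma coefs_in_Xi L : coefs_in (val (Xi (@one_plus_omega n E) (val L))).
Proof.
case: L => w /= _; have [m le_m] : exists m, (size w < m)%N by exists (size
  w).+1.
elim: m => // m IHm in w le_m *; case: (ltnP 1 (size w)) => [w_gt1|];
  last first.
  case: w le_m => [|j [|//]] _ _; first exact: coefs_in1.
  move=> u; rewrite Xi_letter /=; apply: SD; first exact: coefs_in1.
  by rewrite /omega; case: eqP.
have [/andP[c_gt0 lt_c] _ _] := lyndon_cutP w_gt1.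
rewrite Xi_split // /commg /conjg.
have St : coefs_in (val (Xi (@one_plus_omega n E) (take (lyndon_cut w) w))).
  by apply: IHm; rewrite size_takel; lia.
have Sd : coefs_in (val (Xi (@one_plus_omega n E) (drop (lyndon_cut w) w))).
  by apply: IHm; rewrite size_drop; lia.
by rewrite !val_mulO; do !apply: coefs_inM => //; apply: coefs_in_inv.
Qed.

Hypothesis S_binom : forall c m, S c -> S (binom_coef ratE c m).

Lemma coefs_in_lyndon_factor L c : S c -> coefs_in (lyndon_factor ratE L c).
Proof.
move=> Sc w; apply: S_sum => m; apply: SM; first exact: S_binom.
by apply/coefs_inX/coefs_inB; [exact: coefs_in_Xi|exact: coefs_in1].
Qed.

Lemma coefs_in_prod t (s : seq (lyndon_word n)) (P : pred (lyndon_word n)) :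
  (forall L, P L -> S (t L)) ->
  coefs_in (\prod_(L <- s | P L) lyndon_factor ratE L (t L)).
Proof.
move=> St; apply: big_ind => [||L PL]; [exact: coefs_in1|exact: coefs_inM|].
by apply/coefs_in_lyndon_factor/St.
Qed.

(** By [lyndon_prod_coef], [t L] is a coefficient of [g] minus one of a product involving only
    smaller exponents, so membership in [S] propagates by induction on [L]. *)
Lemma lyndon_prod_coefs_in g t :
  (forall w, g w =
    (\prod_(K <- lyndon_upto n (size w)) lyndon_factor ratE K (t K)) w) ->
  coefs_in g <-> forall L, S (t L).
Proof.
move=> gE; split=> [Sg|St w]; last by rewrite gE; apply: coefs_in_prod.
suff St w L : val L = w -> S (t L) by move=> L; apply: (St (val L)).
elim/deglex_ind: w L => w IHw L def_w.
have -> : t L = g (val L) - lyndon_prod_below ratE t (val L) (val L).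
  by rewrite gE lyndon_prod_coef addrK.
apply: SB => //; apply: coefs_in_prod => K lt_K.
by apply: (IHw (val K)) => //; rewrite -def_w.
Qed.

End Subring.

Lemma integers_subring : set_subring (integers E).
Proof.
split=> [|x y|x y]; first by exists 1.
  by move=> [i _ <-] [j _ <-]; exists (i - j) => //; rewrite rmorphB.
by move=> [i _ <-] [j _ <-]; exists (i * j) => //; rewrite rmorphM.
Qed.

Lemma lyndon_prod_inj t t' :
  (forall w,
    (\prod_(K <- lyndon_upto n (size w)) lyndon_factor ratE K (t K)) w =
    (\prod_(K <- lyndon_upto n (size w)) lyndon_factor ratE K (t' K)) w) ->
  t = t'.
Proof.
move=> eq_t; apply/funext => L.
suff eqtL w K : val K = w -> t K = t' K by apply: (eqtL (val L)).
elim/deglex_ind: w K => w IHw K def_w.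
have := eq_t (val K); rewrite !lyndon_prod_coef.
suff -> : lyndon_prod_below ratE t (val K) = lyndon_prod_below ratE t' (val K)
  by move/addIr.
apply: eq_bigr => M lt_M; rewrite (IHw (val M)) // -def_w //.
Qed.

(** Well-founded recursion in which [Phi] takes a total function; by hypothesis only values below
    [w] count, so 0 serves as filler elsewhere. *)
Lemma deglex_rec (Phi : word n -> (word n -> E) -> E) :
  (forall w f h, (forall u, deglex_lt u w -> f u = h u) -> Phi w f = Phi w h) ->
  exists f : word n -> E, forall w, f w = Phi w f.
Proof.
move=> Phi_ext.
pose step w (rec : forall u, deglex_lt u w -> E) :=
  Phi w (fun u => if pselect (deglex_lt u w) is left lt_u then rec u lt_u else
    0).
exists (Fix (@deglex_wf n) (fun=> E) step) => w; rewrite Fix_eq.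
  by apply: Phi_ext => u lt_u; case: pselect.
move=> v f h eq_fh; apply: Phi_ext => u lt_u.
by case: pselect => // ?; rewrite eq_fh.
Qed.

(** The exponents are solved recursively so that the product agrees with [g] at Lyndon words; both
    being group-like, [Fr_eq_lyndon] gives the other words. *)
Lemma lyndon_prod_exists g : Fr n E g -> exists t, forall w,
  g w = (\prod_(K <- lyndon_upto n (size w)) lyndon_factor ratE K (t K)) w.
Proof.
move=> Fr_g.
(* The recursion runs over all words; its values at Lyndon words are the exponents. *)
have [|T TE] := @deglex_rec (fun w f => g w - lyndon_prod_below ratE (f \o val)
  w w).
  move=> w f h eq_fh; congr (_ - _ w); apply: eq_bigr => K lt_K.
  by rewrite /= eq_fh.
exists (T \o val) => w; apply: (@Fr_eq_lyndon _ _ ratE (size w)) => //.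
  by apply: Fr_prod => L; apply/Fr_pow/Fr_Xi.
move=> L L_lyn le_L; have [K def_L] : exists K : lyndon_word n, val K = L by
  exists (Sub L L_lyn).
by rewrite -def_L lyndon_prod_stable ?def_L // -def_L lyndon_prod_coef /= TE
  subrK.
Qed.

End Coefficients.

(** * Closures of subrings and coefficient-wise limits *)

Section Topology.
Variables (n : nat) (E : topComRingType) (ratE : {rmorphism rat -> E}).

Lemma metrizable_hausdorff (R : realType) (T : topologicalType) :
  metrizable R T -> hausdorff_space T.
Proof.
move=> [d [d0 dC d_tri nbhsE]] p q clpq; apply/d0/eqP/negPn/negP => dpq.
have dpp : d p p = 0 by apply/d0.
have e_gt0 : 0 < d p q / 2.
  rewrite divr_gt0 // lt_def dpq /=.
  (* Nonnegativity comes from [0 = d p p <= 2 d p q]. *)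
  by have := d_tri p q p; rewrite dpp [d q p]dC -mulr2n pmulrn_lge0.
have ballP x : nbhs x [set y | d x y < d p q / 2].
  by rewrite nbhsE; exists (d p q / 2).
have [z [/= pz qz]] := clpq _ _ (ballP p) (ballP q).
have := d_tri p z q; rewrite [d z q]dC leNgt => /negP[].
by rewrite [X in _ < X](splitr (d p q)) ltrD.
Qed.

Lemma closure_image2 (S : set E) (f : E * E -> E) : continuous f ->
  (forall x y, S x -> S y -> S (f (x, y))) ->
  forall x y, closure S x -> closure S y -> closure S (f (x, y)).
Proof.
move=> f_cont Sf x y Sx Sy B /f_cont [[U V] /= [Ux Vy] UVB].
have [x' [Sx' Ux']] := Sx _ Ux; have [y' [Sy' Vy']] := Sy _ Vy.
exists (f (x', y')); split; first exact: Sf.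
exact: (UVB (x', y')).
Qed.

Lemma closure_subring (S : set E) : set_subring S -> set_subring (closure S).
Proof.
move=> [S1 SB SM]; split; first exact: subset_closure.
- apply: (@closure_image2 S (fun xy => xy.1 - xy.2)) => // -[x y].
  exact: sub_continuous.
- exact: (@closure_image2 S (fun xy => xy.1 * xy.2) (@mul_continuous E)).
Qed.

Lemma binom_coef_continuous m : continuous (fun c => binom_coef ratE c m).
Proof.
have mul_cvg (u v : E -> E) : continuous u -> continuous v ->
    continuous (fun c => u c * v c).
  move=> cu cv c; exact: (cvg_comp2 (cu c) (cv c) (@mul_continuous E (u c, v
    c))).
elim: m => [|m IHm].
  rewrite (_ : (fun c => _) = fun=> 1); first by move=> c; apply: cvg_cst.
  by apply/funext => c; rewrite binom_coef0.
rewrite (_ : (fun c => _) =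
    fun c => ratE (m.+1%:R^-1) * (c - m%:R) * binom_coef ratE c m); last first.
  by apply/funext => c; rewrite binom_coefS.
apply: (mul_cvg) => //; apply: (mul_cvg) => [c|c]; first exact: cvg_cst.
apply: (cvg_comp2 _ _ (@add_continuous E (c, - m%:R))); first exact: cvg_id.
exact: cvg_cst.
Qed.

(** A neighbourhood of the value pulls back to a neighbourhood of [c], which contains an integer. *)
Lemma closure_integers_binom c m :
  closure (integers E) c -> closure (integers E) (binom_coef ratE c m).
Proof.
move=> Sc B /binom_coef_continuous/Sc[_ [[z _ <-] Bz]].
by exists (binom_coef ratE z%:~R m); split=> //; apply: binom_coef_int.
Qed.

(** Each coefficient of the partial products is eventually constant, and limits are unique; the
    expansion thus becomes an algebraic condition. *)
Lemma lyndon_expansionP (t : lyndon_word n -> E) (g : series n E) :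
  hausdorff_space E -> lyndon_expansion ratE t g <->
  forall w, g w = (\prod_(K <- lyndon_upto n (size w)) lyndon_factor ratE K (t
    K)) w.
Proof.
move=> hE; rewrite /lyndon_expansion series_cvgP.
have cvg_coef w : lyndon_prod ratE t m w @[m --> \oo] -->
    (\prod_(K <- lyndon_upto n (size w)) lyndon_factor ratE K (t K)) w.
  apply: cvg_near_cst; exists (size w) => // m /= le_w.
  exact: lyndon_prod_stable.
split=> [cvg_g w|gE w]; last by rewrite gE; apply: cvg_coef.
exact: (cvg_unique hE (cvg_g w) (cvg_coef w)).
Qed.

End Topology.

Theorem theorem3p4 (R : realType) (n : nat) (E : topComRingType)
    (ratE : {rmorphism rat -> E})
    (n_ge1 : (1 <= n)%N)
    (metrizableE : metrizable R E)
    (ratE_inj : injective ratE) :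
  [/\ forall g : series n E, Fr n E g ->
        exists! t : lyndon_word n -> E, lyndon_expansion ratE t g,
      forall (g : series n E) (t : lyndon_word n -> E),
        Fr n E g -> lyndon_expansion ratE t g ->
        (Fr_coefs n (integers E) g <->
         forall L : lyndon_word n, integers E (t L)) &
      forall (g : series n E) (t : lyndon_word n -> E),
        Fr n E g -> lyndon_expansion ratE t g ->
        (Fr_coefs n (closure (integers E)) g <->
         forall L : lyndon_word n, closure (integers E) (t L))].
Proof.
have hE := metrizable_hausdorff metrizableE.
(* Both integrality statements are instances, for [integers E] and its closure. *)
have coefsP (S : set E) (g : series n E) t : set_subring S ->
    (forall c m, S c -> S (binom_coef ratE c m)) -> Fr n E g ->
    lyndon_expansion ratE t g -> Fr_coefs n S g <-> forall L, S (t L).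
  move=> S_ring S_binom Fr_g /(lyndon_expansionP ratE t g hE) gE.
  rewrite -(lyndon_prod_coefs_in S_ring S_binom gE).
  by split=> [[]|].
split=> [g Fr_g|g t|g t].
- have [t gE] := lyndon_prod_exists ratE Fr_g.
  exists t; split; first exact/lyndon_expansionP.
  move=> t' /(lyndon_expansionP ratE t' g hE) gE'; apply: (@lyndon_prod_inj _ _ ratE).
  by move=> w; rewrite -gE -gE'.
- apply: coefsP; first exact: integers_subring.
  by move=> c m [z _ <-]; apply: binom_coef_int.
- apply: coefsP; first exact/closure_subring/integers_subring.
  by move=> c m; apply: closure_integers_binom.
Qed.
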